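(* Let $k_1\ge 1$ and $k_2\ge 3$ be integers which are both odd. Then $$\sum_{l=1}^{k_1}\sum_{m=1}^{k_2}\binom{k_1-l+m}{m}\binom{k_2-m+l}{l}\,\mathbb{E}(k_1,l)\,\mathbb{G}(k_2,m)\,\tilde T\bigl(\{1\}^{k_1-l+m-1},2,\{1\}^{k_2-m+l}\bigr)=T(k_1+1,k_2)+\tilde T(k_1+1,k_2).$$ (The index of each $\tilde T$ on the left has length $k_1+k_2$, with $2$ in position $k_1-l+m$ and $1$ in all other positions.)
   Context: $\{1\}^n$ denotes $n$ repetitions of $1$. Multiple $T$-values: for $\mathbf{k}=(k_1,\dots,k_r)\in\mathbb{Z}_{\ge1}^r$ with $k_r>1$, $T(\mathbf{k})=2^r\sum \frac{1}{m_1^{k_1}\cdots m_r^{k_r}}$, the sum over integers $0<m_1<\cdots<m_r$ with $m_j\equiv j \pmod 2$ for all $j$. Multiple $\tilde T$-values: for $\mathbf{k}=(k_1,\dots,k_r)\in\mathbb{Z}_{\ge1}^r$, $\tilde T(\mathbf{k})=2^r\sum\frac{(-1)^{(m_r-r)/2}}{m_1^{k_1}\cdots m_r^{k_r}}$, the sum over integers $0<m_1<\cdots<m_r$ with $m_j\equiv j\pmod 2$ for all $j$ (when $k_r=1$ the series is understood as the limit as $M\to\infty$ of the partial sums over $m_r\le M$). $\mathbb{E}(k,j)$ (Entringer number) is the number of permutations $\sigma\in\mathfrak{S}_{k+1}$ with $\sigma(1)=j+1$ that are down-up, i.e. for $1\le i\le k$: $\sigma(i)<\sigma(i+1)$ if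 and only if $i$ is even. $\mathbb{G}(k,j)$ is the number of permutations $\sigma\in\mathfrak{S}_{k-1}$ with $\sigma(1)=j$ that are Dumont permutations (of the first kind), i.e. for $1\le i\le k-2$: $\sigma(i)<\sigma(i+1)$ if and only if $\sigma(i)$ is odd (no condition is imposed on the last value $\sigma(k-1)$). In particular $\mathbb{G}(k,k)=0$. Example: $\mathbb{G}(5,2)=|\{(2,1,3,4),(2,1,4,3)\}|=2$. *)

(* Defs.v *)
From mathcomp Require Import all_boot all_order all_algebra all_fingroup.
From mathcomp Require Import all_classical all_reals all_analysis.

Set Implicit Arguments.
Unset Strict Implicit.
Unset Printing Implicit Defensive.

Import GRing.Theory Num.Theory.
Import numFieldNormedType.Exports.

Local Open Scope ring_scope.

(* [m : r.-tuple 'I_M.+1] stands for integers 0 < m_1 < ... < m_r <= M with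
   m_j = j mod 2; the component m_j is [tnth m i] for the 0-based [i = j - 1]. *)
Definition admissible (M r : nat) (m : r.-tuple 'I_M.+1) : bool :=
  path ltn 0%N (map (@nat_of_ord M.+1) m)
  && [forall i : 'I_r, odd (tnth m i) == odd i.+1].

Definition monomial (R : realType) (k : seq nat) (M : nat)
    (m : (size k).-tuple 'I_M.+1) : R :=
  \prod_(i < size k) ((tnth m i)%:R ^+ nth 0%N k i)^-1.

Definition T_partial (R : realType) (k : seq nat) (M : nat) : R :=
  2 ^+ size k *
  \sum_(m : (size k).-tuple 'I_M.+1 | admissible m) monomial R m.

(* Admissibility gives m_r >= r and m_r = r mod 2, so the truncated difference
   and the halving are exact. *)
Definition Ttilde_partial (R : realType) (k : seq nat) (M : nat) : R :=
  2 ^+ size k *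
  \sum_(m : (size k).-tuple 'I_M.+1 | admissible m)
     (-1) ^+ ((last 0%N (map (@nat_of_ord M.+1) m) - size k)./2)
     * monomial R m.

Definition Tval (R : realType) (k : seq nat) : R :=
  lim (T_partial R k @ \oo)%classic.

Definition Ttilde (R : realType) (k : seq nat) : R :=
  lim (Ttilde_partial R k @ \oo)%classic.

(* In the two definitions below, positions and values of a permutation of
   {1, ..., n} are shifted down by one: sigma(i + 1) = (s i).+1 for s : 'S_n. *)

Definition entringer (k j : nat) : nat :=
  #|[set s : 'S_k.+1 |
      ((s ord0).+1 == j.+1)
      && [forall i : 'I_k.+1, forall i' : 'I_k.+1, (i' == i.+1 :> nat) ==>
           (((s i).+1 < (s i').+1)%N == ~~ odd i.+1)]]|.

Definition dumont (k j : nat) : nat :=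
  #|[set s : 'S_k.-1 |
      [exists i : 'I_k.-1, (i == 0%N :> nat) && ((s i).+1 == j)]
      && [forall i : 'I_k.-1, forall i' : 'I_k.-1, (i' == i.+1 :> nat) ==>
           (((s i).+1 < (s i').+1)%N == odd (s i).+1)]]|.

(* Main.v *)
(** Put [y = 2 atan x].  The generating functions of the [Ttilde]-values are
    iterated integrals of [2 dx / (1 + x^2) = dy] and [dx / x = dy / sin y], so
    [Ttilde({1}^a, 2, {1}^b)] is the integral over [[0, pi / 2]] of
    [y^(a+1) (pi/2 - y)^b / ((a+1)! b! sin y)].  Hence the left-hand side is the
    integral of [P(y) Q(y) / sin y], where [P] and [Q] are the binary forms in
    [y] and [pi / 2 - y] with the Entringer and Dumont numbers as coefficients.
    The boustrophedon recurrence gives [P'' = - P] with the degree lowered by 2,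
    so the integral of [P(y) cos (j y)] is [j^-(k1+1)] for odd [j].  A second
    difference recurrence for the Dumont numbers shows that [Q] is the sum of
    [4 sin (2 n y) / (2 n)^k2] over odd [n].  Since [sin (2 n y) / sin y] is
    twice the sum of [cos (j y)] over odd [j < 2 n], integrating termwise gives
    [8 sum_(n odd) (2 n)^-k2 sum_(j odd, j < 2 n) j^-(k1+1)], which is
    [T + Ttilde] because [1 + (-1)^((m - 2) / 2)] selects [m = 2 n], [n] odd. *)
Require Import Defs.
From mathcomp Require Import all_boot all_order all_algebra all_fingroup.
From mathcomp Require Import all_classical all_reals all_analysis.
From mathcomp Require Import ring lra zify.

Set Implicit Arguments.
Unset Strict Implicit.
Unset Printing Implicit Defensive.

(** The binomial coefficients merge divided powers: [C(k1-l+m, m)] turns the product of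
    [y^(k1-l) / (k1-l)!] and [y^m / m!] into [y^(k1-l+m) / (k1-l+m)!], and the other one does the
    same for [pi / 2 - y]; this is why the double sum factors as [P(y) Q(y)]. Two obstacles shape
    the analysis. At [x = 1] absolute convergence cannot be relied on, so truncated series are
    compared with their limits on all of [[0, 1]]. At [x = 0] the form [dx / x] is singular, so
    errors must be [O(x)]: hence bounds of the shape [e * x], and a sine series for [Q] obtained
    from a uniform estimate of the error in [Q']. On the combinatorial side, deleting a letter from
    a Dumont word destroys the alternation of its labels. Words with arbitrary ascent labels are
    therefore counted, and the recurrence comes from exchanging two neighbouring labels. *)

(** * Counting permutations by deletion of the first letter *)

Definition ruled_by (c : nat -> nat -> bool) n (s : 'S_n) : bool :=
  [forall i : 'I_n, forall i' : 'I_n, (i' == i.+1 :> nat) ==>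
     ((s i < s i') == c i (s i))].

Definition ruled_perms (n : nat) (c : nat -> nat -> bool) (j : nat) : nat :=
  #|[set s : 'S_n.+1 | (s ord0 == j :> nat) && ruled_by c s]|.

(** The first letter [j] is deleted and the rest standardized: a remaining letter [v] was
    [bump j v], so the rule is transported along [bump j], and [j < bump j i] reads [j <= i]. A rule
    may look at position and value, which covers Entringer and Dumont permutations alike. At [n = 0]
    the value is 1 whatever [j] is, hence the assumptions [j <= n] below. *)
Fixpoint ruled_words (n : nat) (c : nat -> nat -> bool) (j : nat) : nat :=
  if n is n'.+1 then
    \sum_(i < n'.+1 | (j <= i) == c 0 j)
       ruled_words n' (fun p v => c p.+1 (bump j v)) i
  else 1.

Lemma lift_lt n (h : 'I_n.+1) (i j : 'I_n) : (lift h i < lift h j) = (i < j).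
Proof. by rewrite /= ltnNge leq_bump2 -ltnNge. Qed.

Lemma ltn_bump j i : (j < bump j i) = (j <= i).
Proof. by rewrite /bump; case: (leqP j i) => h; lia. Qed.

Lemma lift_perm_surj n (s : 'S_n.+2) : exists t, s = lift_perm ord0 (s ord0) t.
Proof.
have unl k : exists k', unlift (s ord0) (s (lift ord0 k)) = Some k'.
  case: unliftP => [k' _|e]; first by exists k'.
  by move/perm_inj: e => /eqP; rewrite eq_sym (negbTE (neq_lift _ _)).
(* By [unl] the [unlift] always succeeds, so the default [k] is never taken. *)
pose t k := odflt k (unlift (s ord0) (s (lift ord0 k))).
have tE k : lift (s ord0) (t k) = s (lift ord0 k).
  rewrite /t; have [k' e] := unl k; rewrite e /=.
  by move: e; case: unliftP => // j -> [->].
have tinj : injective t.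
  move=> k k' e; apply: (@lift_inj _ ord0); apply: (@perm_inj _ s).
  by rewrite -!tE e.
exists (perm tinj); apply/permP => k.
have [k' ->|->] := unliftP ord0 k; first by rewrite lift_perm_lift permE tE.
by rewrite lift_perm_id.
Qed.

Lemma ruled_by_lift n c (j : 'I_n.+2) (t : 'S_n.+1) :
  ruled_by c (lift_perm ord0 j t) =
  ((j <= t ord0) == c 0 j) && ruled_by (fun p v => c p.+1 (bump j v)) t.
Proof.
apply/forallP/andP => [H|[H0 H] i].
  split.
    have /forallP/(_ (lift ord0 ord0))/implyP := H ord0.
    rewrite lift_perm_id lift_perm_lift /= => /(_ (eqxx _)) /eqP <-.
    by rewrite ltn_bump.
  apply/forallP => i; apply/forallP => i'; apply/implyP => /eqP e.
  have /forallP/(_ (lift ord0 i'))/implyP := H (lift ord0 i).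
  rewrite !lift_perm_lift lift_lt !lift0 => -> //.
  by rewrite e.
apply/forallP => i'; apply/implyP => /eqP e.
have [k' e'|e'] := unliftP ord0 i'; last by rewrite e' in e.
move: e; rewrite {}e' lift_perm_lift.
have [k ->|->] := unliftP ord0 i; rewrite ?lift_perm_lift ?lift_perm_id.
  rewrite lift_lt !lift0 => -[e].
  by have /forallP/(_ k')/implyP -> := forallP H k; rewrite ?e.
rewrite lift0 => -[k'0].
have -> : k' = ord0 by apply: val_inj.
by rewrite -(eqP H0) -[X in X == _]/(j < bump j _) ltn_bump.
Qed.

Lemma ruled_permsE n c j : j <= n -> ruled_perms n c j = ruled_words n c j.
Proof.
elim: n c j => [|n IHn] c j jn.
  move: jn; rewrite leqn0 => /eqP -> /=; rewrite /ruled_perms.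
  rewrite (_ : [set _ | _] = [set 1%g]) ?cards1 //; apply/setP => s.
  rewrite !inE; have -> : s = 1%g by apply/permP => i; rewrite !ord1.
  rewrite perm1 eqxx /=; apply/forallP => i; apply/forallP => i'.
  by rewrite !ord1.
pose J := Ordinal (jn : j < n.+2); rewrite /ruled_perms.
have -> : [set s : 'S_n.+2 | (s ord0 == j :> nat) && ruled_by c s] =
    lift_perm ord0 J @: [set t : 'S_n.+1 | ((J <= t ord0) == c 0 J)
        && ruled_by (fun p v => c p.+1 (bump J v)) t].
  apply/setP => s; apply/idP/imsetP => [|[t ht ->]]; rewrite inE.
    case/andP => /eqP sj; have [t ->] := lift_perm_surj s.
    have -> : s ord0 = J by apply: val_inj.
    by rewrite ruled_by_lift => ht; exists t; rewrite ?inE.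
  by move: ht; rewrite inE -ruled_by_lift lift_perm_id eqxx.
rewrite card_imset; last first.
  move=> t t' /permP e; apply/permP => k; apply: (@lift_inj _ J).
  by have := e (lift ord0 k); rewrite !lift_perm_lift.
rewrite -sum1_card (partition_big (fun t : 'S_n.+1 => t ord0)
  (fun i : 'I_n.+1 => (j <= i) == c 0 j)) /=; last first.
  by move=> t; rewrite inE => /andP[].
apply: eq_bigr => i hi; rewrite -IHn -1?ltnS // sum1dep_card.
apply: eq_card => t; rewrite !inE /= -val_eqE.
by case: (eqVneq (t ord0 : nat) i) => [-> |]; rewrite ?hi ?andbT ?andbF.
Qed.

Lemma eq_ruled_words n c c' j : j <= n ->
  (forall p v, p < n -> v <= n -> c p v = c' p v) -> ruled_words n c j = ruled_words n c' j.
Proof.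
elim: n c c' j => //= n IHn c c' j jn cc'; rewrite (cc' 0) //.
apply: eq_bigr => i _; apply: IHn => [|p v pn vn]; first exact: leq_ord.
by apply: cc' => //; rewrite /bump; lia.
Qed.

(** * Entringer numbers and the boustrophedon recurrence *)

(** The flag [b] tells whether the first step ascends. *)
Definition zigzag n (b : bool) := ruled_words n (fun p _ => odd p (+) b).

Lemma zigzagS n b j :
  zigzag n.+1 b j = \sum_(i < n.+1 | (j <= i) == b) zigzag n (~~ b) i.
Proof.
apply: eq_bigr => i _; apply: eq_ruled_words => [|p v _ _]; first exact: leq_ord.
by rewrite /= addNb addbN.
Qed.

Lemma entringerE k j : j <= k -> entringer k j = zigzag k false j.
Proof.
move=> jk; rewrite /zigzag -ruled_permsE //; apply: eq_card => s; rewrite !inE eqSS.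
congr (_ && _); apply: eq_forallb => i; apply: eq_forallb => i' /=.
by rewrite ltnS negbK addbF.
Qed.

Lemma zigzag_down0 n : zigzag n.+1 false 0 = 0.
Proof. by rewrite zigzagS big_pred0. Qed.

Lemma zigzag_up_max n : zigzag n.+1 true n.+1 = 0.
Proof. by rewrite zigzagS big_pred0 // => i; rewrite leqNgt ltn_ord. Qed.

(** Raising the first letter from [j] to [j.+1] admits exactly one more second letter, namely
    [j]. *)
Lemma zigzag_downS n j : j <= n ->
  zigzag n.+1 false j.+1 = zigzag n.+1 false j + zigzag n true j.
Proof.
move=> jn; rewrite !zigzagS (bigD1 (Ordinal (jn : j < n.+1))) /= ?ltnn // addnC.
congr (_ + _); apply: eq_bigl => i; rewrite -val_eqE /=; lia.
Qed.

Lemma zigzag_upS n j : j <= n ->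
  zigzag n.+1 true j = zigzag n.+1 true j.+1 + zigzag n false j.
Proof.
move=> jn; rewrite !zigzagS (bigD1 (Ordinal (jn : j < n.+1))) /= ?leqnn // addnC.
congr (_ + _); apply: eq_bigl => i; rewrite -val_eqE /=; lia.
Qed.

(** * Words whose ascents are prescribed by labels on the letters *)

Definition labelled_words n (w : nat -> bool) := ruled_words n (fun _ => w).

Lemma labelled_wordsS n w j : labelled_words n.+1 w j =
  \sum_(i < n.+1 | (j <= i) == w j) labelled_words n (w \o bump j) i.
Proof. by []. Qed.

Lemma eq_labelled_words n w w' j : j <= n ->
  (forall v, v <= n -> w v = w' v) -> labelled_words n w j = labelled_words n w' j.
Proof. by move=> jn ww'; apply: eq_ruled_words => // p v _; apply: ww'. Qed.

Lemma labelled_words_up n (w : nat -> bool) p : p <= n -> w p ->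
  labelled_words n.+1 w p = \sum_(i < n.+1 | p <= i) labelled_words n (w \o bump p) i.
Proof. by move=> pn wp; rewrite labelled_wordsS wp; apply: eq_bigl => i; rewrite eqb_id. Qed.

Lemma labelled_words_down n (w : nat -> bool) p : ~~ w p ->
  labelled_words n.+1 w p = \sum_(i < n.+1 | i < p) labelled_words n (w \o bump p) i.
Proof.
move=> /negbTE wp; rewrite labelled_wordsS wp; apply: eq_bigl => i.
by rewrite eqbF_neg -ltnNge.
Qed.

Lemma sum_ord_geD1 n p (F : nat -> nat) : p <= n ->
  \sum_(i < n.+1 | p <= i) F i = F p + \sum_(i < n.+1 | p < i) F i.
Proof.
move=> pn; rewrite (bigD1 (Ordinal (pn : p < n.+1))) /= ?leqnn //.
congr (_ + _); apply: eq_bigl => i; rewrite -val_eqE /=; lia.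
Qed.

Lemma sum_ord_ltD1 n p (F : nat -> nat) : p <= n ->
  \sum_(i < n.+1 | i < p.+1) F i = F p + \sum_(i < n.+1 | i < p) F i.
Proof.
move=> pn; rewrite (bigD1 (Ordinal (pn : p < n.+1))) /= ?ltnSn //.
congr (_ + _); apply: eq_bigl => i; rewrite -val_eqE /=; lia.
Qed.

(* The labels at [p] and [p.+1] are exchanged. *)
Definition swapped p (w w' : nat -> bool) :=
  [/\ w p, ~~ w p.+1, ~~ w' p, w' p.+1 &
      forall v, v != p -> v != p.+1 -> w v = w' v].

(** Exchanging the letters [p] and [p.+1] together with their labels preserves all comparisons of
    consecutive letters unless the two are adjacent. Here they are adjacent only in words beginning
    [p, p.+1]; the last term counts these, with [p] deleted. *)
Lemma swapped_start_up n p w w' : swapped p w w' -> p <= n ->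
  labelled_words n.+1 w p =
  labelled_words n.+1 w' p.+1 + labelled_words n (w \o bump p) p.
Proof.
case=> wp wp1 w'p w'p1 ww' pn; rewrite labelled_words_up //.
rewrite (sum_ord_geD1 _ pn) addnC; congr (_ + _).
rewrite labelled_wordsS w'p1; apply: eq_big => i; first by rewrite eqb_id.
move=> _; apply: eq_labelled_words => [|v vn /=]; first exact: leq_ord.
have [->|vp] := eqVneq v p.
  by rewrite /bump leqnn ltnn add0n add1n (negbTE wp1) (negbTE w'p).
have -> : bump p.+1 v = bump p v by rewrite /bump; lia.
by apply: ww'; rewrite /bump; lia.
Qed.

Lemma swapped_start_down n p w w' : swapped p w w' -> p <= n ->
  labelled_words n.+1 w p.+1 =
  labelled_words n.+1 w' p + labelled_words n (w \o bump p.+1) p.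
Proof.
case=> wp wp1 w'p w'p1 ww' pn; rewrite labelled_words_down //.
rewrite (sum_ord_ltD1 _ pn) addnC; congr (_ + _).
rewrite labelled_words_down //; apply: eq_bigr => i _.
apply: eq_labelled_words => [|v vn /=]; first exact: leq_ord.
have [->|vp] := eqVneq v p.
  by rewrite /bump leqnn ltnn add0n add1n wp w'p1.
have -> : bump p.+1 v = bump p v by rewrite /bump; lia.
by apply: ww'; rewrite /bump; lia.
Qed.

(** The index [i] on the right ranges over the letters after [q] and [q.+1] have been contracted to
    one. *)
Lemma sum_ord_merge n q (F : nat -> nat) : q <= n ->
  \sum_(i < n.+2) F i =
  \sum_(i < n.+1) (if (i : nat) == q then F q + F q.+1 else F (bump q i)).
Proof.
move=> qn; pose Q := Ordinal (qn : q < n.+1).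
rewrite (bigD1_ord (widen_ord (leqnSn _) Q)) //= (bigD1 Q) //= [RHS](bigD1 Q) //=.
rewrite eqxx addnA {1}/bump leqnn add1n; congr (_ + _).
by apply: eq_bigr => i; rewrite -?val_eqE //= => /negbTE ->.
Qed.

(** Under [w'] the letters [p] and [p.+1] are never adjacent, since [p] must descend and [p.+1]
    ascend. The two extra terms count the words for [w] that contain [p, p.+1] or [p.+1, p] in
    succession, with the first letter of the pair deleted. The induction strips first letters until
    one of the pair comes up, where the two preceding lemmas take over. *)
Lemma swapped_elsewhere n p w w' s : swapped p w w' -> p <= n -> s <= n -> s != p ->
  labelled_words n.+1 w (bump p s) = labelled_words n.+1 w' (bump p s)
    + (labelled_words n (w \o bump p) s + labelled_words n (w \o bump p.+1) s).
Proof.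
elim: n p w w' s => [|n IHn] p w w' s sw pn sn sp; first by lia.
have [wp wp1 w'p w'p1 ww'] := sw.
(* [q] is the place of [p] among the letters left after the deletion of [t]. *)
set t := bump p s; pose q := if s < p then p.-1 else p.
have qn : q <= n by rewrite /q; case: ltnP; lia.
have tq : bump t q = p /\ bump t q.+1 = p.+1.
  by rewrite /t /q /bump; case: (ltnP s p) => h; lia.
have swq : swapped q (w \o bump t) (w' \o bump t).
  case: tq => tq tq1; split; rewrite /= ?tq ?tq1 // => v vq vq1; apply: ww'.
    by rewrite -tq (can_eq (bumpK t)).
  by rewrite -tq1 (can_eq (bumpK t)).
have wt : w t = w' t by apply: ww'; rewrite /t /bump; lia.
have ts : w t = w (bump p s) /\ w t = w (bump p.+1 s).
  by split=> //; congr w; rewrite /t /bump; lia.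
pose F W i := if (t <= i) == w t then labelled_words n.+1 W i else 0.
have FE W : W t = w t -> labelled_words n.+2 W t = \sum_(i < n.+1)
    (if (i : nat) == q then F (W \o bump t) q + F (W \o bump t) q.+1
     else F (W \o bump t) (bump q i)).
  by move=> Wt; rewrite labelled_wordsS Wt big_mkcond -(sum_ord_merge _ qn).
have GE r : w t = w (bump r s) -> labelled_words n.+1 (w \o bump r) s =
    \sum_(i < n.+1) if (s <= i) == w t
      then labelled_words n ((w \o bump r) \o bump s) i else 0.
  by move=> e; rewrite labelled_wordsS -big_mkcond /= e.
rewrite !FE // (GE _ ts.1) (GE _ ts.2) -!big_split; apply: eq_bigr => i _.
have [delp delp1] : (forall v, w (bump p (bump s v)) = w (bump t (bump q v)))
    /\ (forall v, w (bump p.+1 (bump s v)) = w (bump t (bump q.+1 v))).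
  by split=> v; congr w; rewrite /t /q /bump; case: (ltnP s p) => h; lia.
have lwE r r' : (forall v, w (bump r (bump s v)) = w (bump t (bump r' v))) ->
    labelled_words n ((w \o bump r) \o bump s) i =
    labelled_words n ((w \o bump t) \o bump r') i.
  by move=> e; apply: eq_labelled_words => [|v _]; [exact: leq_ord|exact: e].
rewrite (lwE _ _ delp) (lwE _ _ delp1) /F.
have [iq|iq] := eqVneq (i : nat) q.
  have -> : (t <= q) = (s <= i) by rewrite iq /t /q /bump; case: (ltnP s p) => h; lia.
  have -> : (t <= q.+1) = (s <= i) by rewrite iq /t /q /bump; case: (ltnP s p) => h; lia.
  case: ifP => // _; rewrite iq (swapped_start_up swq qn) (swapped_start_down swq qn).
  by rewrite /comp /=; lia.
have -> : (t <= bump q i) = (s <= i).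
  by rewrite /t /q; rewrite /bump; case: (ltnP s p) => h; lia.
by case: ifP => // _; apply: IHn => //; apply: leq_ord.
Qed.

(** Complementation of the letters exchanges ascents and descents. *)
Lemma labelled_words_rev n w w' j : j <= n ->
  (forall v, v <= n -> w' (n - v) = ~~ w v) ->
  labelled_words n w' (n - j) = labelled_words n w j.
Proof.
elim: n w w' j => [|n IHn] w w' j jn ww' //.
rewrite !labelled_wordsS ww' // (reindex_inj rev_ord_inj) /=.
apply: eq_big => i.
  by case: (w j); case: leqP; case: leqP => //=; have := ltn_ord i; lia.
move=> _; rewrite subSS (IHn (w \o bump j)) // => [|v vn /=]; first exact: leq_ord.
have -> : bump (n.+1 - j) (n - v) = n.+1 - bump j v by rewrite /bump; lia.
by rewrite ww' // /bump; lia.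
Qed.

(** * Dumont numbers and their second difference *)

(** Letters are counted from 0, so the odd values of a Dumont permutation are the even letters
    here. *)
Definition dumont_words n := labelled_words n (fun v => ~~ odd v).

Lemma dumont_words_rev n j : odd n -> j <= n ->
  dumont_words n (n - j) = dumont_words n j.
Proof. by move=> on jn; apply: labelled_words_rev => // v vn; rewrite oddB // on. Qed.

(** The words starting with [p] are counted in two ways for the labelling [w], which exchanges the
    Dumont labels at [p.+1] and [p.+2]. Undoing the exchange leads to Dumont words starting with
    [p]. Moving the start to [p.+1], which also ascends under [w], and undoing the exchange there
    leads to Dumont words starting with [p.+2]. In the extra terms that do not cancel two letters
    have been deleted, and the labels alternate again. *)
Lemma dumont_words_even n p : p <= n -> ~~ odd p ->
  dumont_words n.+2 p + \sum_(i < n.+1 | p <= i) dumont_words n i =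
  dumont_words n.+2 p.+2 + \sum_(i < n.+1 | i < p.+1) dumont_words n i.
Proof.
move=> pn ep; pose w (v : nat) := if v == p.+1 then true else
  if v == p.+2 then false else ~~ odd v.
have wE v : v != p.+1 -> v != p.+2 -> w v = ~~ odd v.
  by rewrite /w => /negbTE -> /negbTE ->.
have wp1 : w p.+1 by rewrite /w eqxx.
have wp2 : ~~ w p.+2 by rewrite /w eqxx; case: eqP => //; lia.
have wp : w p by rewrite wE //; lia.
have sw : swapped p.+1 w (fun v => ~~ odd v).
  by split => //=; rewrite negbK.
have pn1 : p <= n.+1 by lia.
have e1 := swapped_elsewhere sw (pn : p.+1 <= n.+1) pn1 (negbT (ltn_eqF (ltnSn p))).
have e2 := swapped_start_up sw (pn : p.+1 <= n.+1).
(* The words beginning [p, p.+1] give the first summand, which also occurs in [e1]; in the others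
   [p] may be replaced by [p.+1], which carries the same label. *)
have e3 : labelled_words n.+2 w p =
    labelled_words n.+1 (w \o bump p.+1) p + labelled_words n.+2 w p.+1.
  rewrite [LHS]labelled_words_up // (sum_ord_geD1 _ pn1).
  rewrite (@labelled_words_up n.+1 w p.+1) //.
  have wb v : (w \o bump p) v = (w \o bump p.+1) v.
    have [->|vp] := eqVneq v p; first by rewrite /= /bump leqnn ltnn wp1 wp.
    by congr w; rewrite /bump; lia.
  congr (_ + _); first by apply: eq_labelled_words.
  by apply: eq_bigr => i _; apply: eq_labelled_words => //; exact: leq_ord.
have e4 : labelled_words n.+1 (w \o bump p.+2) p =
    \sum_(i < n.+1 | p <= i) dumont_words n i.
  have bp : bump p.+2 p = p by rewrite /bump; lia.
  rewrite labelled_words_up //= ?bp //; apply: eq_bigr => i _.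
  apply: eq_labelled_words => [|v _ /=]; first exact: leq_ord.
  have [->|vp] := eqVneq v p.
    have -> : bump p.+2 (bump p p) = p.+1 by rewrite /bump; lia.
    by rewrite wp1 ep.
  rewrite wE; [congr (~~ _)| |]; rewrite /bump; lia.
have e5 : labelled_words n.+1 (w \o bump p.+1) p.+1 =
    \sum_(i < n.+1 | i < p.+1) dumont_words n i.
  have bp : bump p.+1 p.+1 = p.+2 by rewrite /bump; lia.
  rewrite labelled_words_down /= ?bp //; apply: eq_bigr => i _.
  apply: eq_labelled_words => [|v _ /=]; first exact: leq_ord.
  rewrite wE; [congr (~~ _)| |]; rewrite /bump; lia.
have bp : bump p.+1 p = p by rewrite /bump; lia.
rewrite bp in e1; rewrite -e4 -e5 /dumont_words; lia.
Qed.

(* Shifted so as to match the indexing of [dumont]. *)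
Definition dumont_count n m :=
  if m is v.+1 then (if v <= n then dumont_words n v else 0) else 0.

Lemma dumontE n m : dumont n.+2 m = dumont_count n m.
Proof.
rewrite /dumont; case: m => [|v] /=.
  apply: eq_card0 => s; rewrite !inE; apply/negbTE/nandP; left.
  by apply/existsP => -[i]; rewrite andbF.
case: leqP => vn; last first.
  apply: eq_card0 => s; rewrite !inE; apply/negbTE/nandP; left.
  apply/existsP => -[i /andP[_]]; rewrite eqSS => /eqP e.
  by have := ltn_ord (s i); rewrite e; lia.
rewrite /dumont_words /labelled_words -ruled_permsE //.
apply: eq_card => s; rewrite !inE; congr (_ && _).
apply/existsP/eqP => [[i /andP[/eqP i0]]|<-]; last first.
  by exists ord0; apply/andP; split; rewrite ?eqxx.
by rewrite eqSS => /eqP <-; congr (val (s _)); apply: val_inj.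
Qed.

Lemma dumont_count_rev n m : odd n -> m <= n.+2 ->
  dumont_count n (n.+2 - m) = dumont_count n m.
Proof.
move=> on; case: m => [|v] mn; first by rewrite subn0 /= ltnn.
rewrite subSS; have [vn|] := leqP v n; last first.
  by move=> nv; rewrite (_ : n.+1 - v = 0) /=; [case: leqP => //; lia | lia].
rewrite subSn //= leq_subr vn; exact: dumont_words_rev.
Qed.

Lemma sum_dumont_words n m : m <= n.+1 ->
  \sum_(i < n.+1 | i < m) dumont_words n i = \sum_(0 <= i < m.+1) dumont_count n i.
Proof.
move=> mn; rewrite big_nat_recl // add0n big_mkord.
rewrite (big_ord_widen_cond _ xpredT (fun i => dumont_count n i.+1) mn) /=.
by apply: eq_bigr => i im /=; rewrite leq_ord.
Qed.

(** The letter 1 must descend, hence to 0, which any letter may follow. *)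
Lemma dumont_words_1 n :
  dumont_words n.+2 1 = \sum_(i < n.+1) dumont_words n i.
Proof.
rewrite /dumont_words labelled_words_down // (sum_ord_ltD1 _ (leq0n _)) big_pred0 //.
rewrite addn0 labelled_words_up //=; apply: eq_bigr => i _.
apply: eq_labelled_words => [|v _]; first exact: leq_ord.
have e : bump 1 (bump 0 v) = v.+2 by rewrite /bump; lia.
by rewrite -[LHS]/(~~ odd (bump 1 (bump 0 v))) e /= negbK.
Qed.

Lemma sum_dumont_count_max n :
  \sum_(0 <= i < n.+3) dumont_count n i = \sum_(0 <= i < n.+2) dumont_count n i.
Proof. by rewrite big_nat_recr //= ltnn addn0. Qed.

Lemma sum_dumont_count_rev n m : odd n -> m <= n.+3 ->
  \sum_(0 <= i < n.+3 - m) dumont_count n i + \sum_(0 <= i < m) dumont_count n i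
  = \sum_(0 <= i < n.+2) dumont_count n i.
Proof.
move=> on mn; rewrite -sum_dumont_count_max.
rewrite (big_cat_nat (n := n.+3 - m) (p := n.+3)) ?leq_subr //=; congr (_ + _).
rewrite -{1}[n.+3 - m]add0n big_addn subKn // big_nat_rev /=.
rewrite [LHS]big_nat [RHS]big_nat; apply: eq_bigr => i im.
by rewrite -dumont_count_rev //; [congr dumont_count|]; lia.
Qed.

(** For odd [j <= n] this is [dumont_words_even], and for positive even [j] its mirror image under
    complementation; the ends [j = 0] and [j = n.+2] rest on [dumont_words_1]. *)
Lemma dumont_count_diff n j : odd n -> j <= n.+2 ->
  dumont_count n.+2 j.+2 + \sum_(0 <= i < j) dumont_count n i
    + \sum_(0 <= i < j.+1) dumont_count n i =
  dumont_count n.+2 j + \sum_(0 <= i < n.+2) dumont_count n i.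
Proof.
move=> on; have even_case p : p <= n -> ~~ odd p ->
    dumont_count n.+2 p.+3 + \sum_(0 <= i < p.+1) dumont_count n i
    + \sum_(0 <= i < p.+2) dumont_count n i =
    dumont_count n.+2 p.+1 + \sum_(0 <= i < n.+2) dumont_count n i.
  move=> pn ep; have := dumont_words_even pn ep; rewrite /= !ltnS pn (leqW (leqW pn)).
  have -> : \sum_(0 <= i < n.+2) dumont_count n i =
      \sum_(i < n.+1 | i < p) dumont_words n i + \sum_(i < n.+1 | p <= i) dumont_words n i.
    rewrite -sum_dumont_words // (bigID (fun i : 'I_n.+1 => i < p)) /=.
    by congr (_ + _); apply: eq_bigl => i; rewrite ltn_ord // -leqNgt.
  rewrite -!sum_dumont_words ?(leqW pn) // => e.
  by rewrite [RHS]addnCA e -addnA addnCA.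
have zero_case : dumont_count n.+2 2 = \sum_(0 <= i < n.+2) dumont_count n i.
  rewrite /= dumont_words_1 -sum_dumont_words //; apply: eq_bigl => i.
  by rewrite ltn_ord.
case: j => [_|j]; first by rewrite zero_case big_nil big_nat1 /= !addn0 add0n.
rewrite ltnS leq_eqVlt => /predU1P[->|jn]; last have [oj|ej] := boolP (odd j).
- rewrite sum_dumont_count_max {1}/dumont_count ltnn add0n.
  have <- : dumont_count n.+2 2 = dumont_count n.+2 n.+2; last by rewrite zero_case.
  by rewrite -(@dumont_count_rev n.+2 2) ?subSS ?subn0 //= negbK.
- have := even_case (n - j); rewrite leq_subr oddB // on oj => /(_ isT isT).
  have -> : (n - j).+3 = n.+4 - j.+1 by lia.
  have -> : (n - j).+2 = n.+3 - j.+1 by lia.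
  have -> : (n - j).+1 = n.+4 - j.+3 by lia.
  rewrite !dumont_count_rev ?negbK //; try lia.
  have := @sum_dumont_count_rev n j.+1 on; have := @sum_dumont_count_rev n j.+2 on.
  have -> : n.+3 - j.+2 = n.+4 - j.+3 by lia.
  lia.
- exact: even_case.
Qed.

Arguments dumont_count : simpl never.

(* The defects of the claimed identity alternate in sign by [dumont_count_diff]
   and are symmetric about the middle by [dumont_count_rev], hence vanish. *)
Lemma dumont_count_recurrence n m : odd n -> m <= n.+2 ->
  dumont_count n.+2 m.+2 + dumont_count n.+2 m + dumont_count n m =
  (dumont_count n.+2 m.+1).*2.
Proof.
move=> on mn.
pose L j := dumont_count n.+2 j.+2 + dumont_count n.+2 j + dumont_count n j.
pose D j := (dumont_count n.+2 j.+1).*2.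
have alt j : j <= n.+1 -> L j + L j.+1 = D j + D j.+1.
  move=> jn; have := dumont_count_diff on (leqW jn); have := dumont_count_diff on (jn : j.+1 <= n.+2).
  rewrite !(big_nat_recr j.+1) // (big_nat_recr j) // /=.
  move: (\sum_(0 <= i < j) _) (\sum_(0 <= i < n.+2) _) => S S'.
  rewrite /L /D; lia.
have rev j : j <= n.+2 -> L (n.+2 - j) = L j /\ D (n.+2 - j) = D j.
  move=> jn; have on2 : odd n.+2 by rewrite /= negbK.
  have e1 : (n.+2 - j).+2 = n.+4 - j by lia.
  have e2 : (n.+2 - j).+1 = n.+4 - j.+1 by lia.
  have e3 : n.+2 - j = n.+4 - j.+2 by lia.
  rewrite /L /D (dumont_count_rev on jn) e1 e2 e3.
  rewrite !(dumont_count_rev on2); lia.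
have sgn j : j <= n.+2 ->
    if odd j then L j + L 0 = D j + D 0 else L j + D 0 = D j + L 0.
  elim: j => [|j IHj] jn; first by rewrite addnC.
  have := IHj (ltnW jn); have := alt j jn; rewrite /=; case: (odd j) => /=; lia.
have L0 : L 0 = D 0.
  have := sgn _ (leqnn _); have := rev _ (leqnn _); rewrite subnn /= negbK on.
  by move=> [<- <-]; lia.
have := sgn m mn; rewrite -/(L m) -/(D m); case: ifP; lia.
Qed.

Import Order.TTheory GRing.Theory Num.Theory.
Import numFieldNormedType.Exports.

Local Open Scope classical_set_scope.
Local Open Scope ring_scope.

(** * Integrals as primitives on a closed interval *)

Section Primitives.
Variable R : realType.
Implicit Types (f g df dg : R -> R) (a b x : R).

Lemma is_derive_sum_fun n (h dh : nat -> R -> R) x :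
  (forall i, (i < n)%N -> is_derive x 1 (h i) (dh i x)) ->
  is_derive x 1 (fun t => \sum_(i < n) h i t) (\sum_(i < n) dh i x).
Proof.
elim: n => [|n IHn] hd.
  rewrite big_ord0; have -> : (fun t => \sum_(i < 0) h i t) = cst 0.
    by apply/funext => t; rewrite big_ord0.
  exact: is_derive_cst.
rewrite big_ord_recr /=.
have -> : (fun t => \sum_(i < n.+1) h i t) = (fun t => \sum_(i < n) h i t) + h n.
  by apply/funext => t; rewrite big_ord_recr.
by apply: is_deriveD; [apply: IHn => i ni; apply: hd; exact: ltnW|exact: hd].
Qed.

Lemma is_derive_expr f n x (d : R) : is_derive x 1 f d ->
  is_derive x 1 (fun t => f t ^+ n) (n%:R * f x ^+ n.-1 * d).
Proof.
move=> fd; have -> : (fun t => f t ^+ n) = f ^+ n by apply/funext => t; rewrite exprfctE.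
exact: is_deriveX.
Qed.

Lemma is_derive_exprn n x : is_derive x 1 (fun t : R => t ^+ n) (n%:R * x ^+ n.-1).
Proof. by rewrite -[_ * _]mulr1; apply: is_derive_expr; exact: is_derive_id. Qed.

Lemma is_derive_continuous f x (d : R) : is_derive x 1 f d -> {for x, continuous f}.
Proof.
by move=> fx; apply: differentiable_continuous; apply/derivable1_diffP; exact: ex_derive.
Qed.

(** Differentiability is asked only inside, so that an integrand such as [F x / x] needs no
    meaningful value at an end point. *)
Definition primitive_on a b f df :=
  {within `[a, b], continuous f} /\ forall x, a < x < b -> is_derive x 1 f (df x).

Lemma derive_primitive_on a b f df :
  (forall x, is_derive x 1 f (df x)) -> primitive_on a b f df.
Proof.
by move=> fd; split=> // x; apply: continuous_subspaceT => t; exact: is_derive_continuous.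
Qed.

Lemma eq_primitive_on a b f df dg : primitive_on a b f df ->
  (forall x, a < x < b -> df x = dg x) -> primitive_on a b f dg.
Proof. by case=> cf fd e; split=> // x xab; rewrite -e //; exact: fd. Qed.

Lemma primitive_onD a b f df g dg : primitive_on a b f df -> primitive_on a b g dg ->
  primitive_on a b (fun x => f x + g x) (fun x => df x + dg x).
Proof.
move=> [cf fd] [cg gd]; split=> [x|x xab]; first by apply: cvgD; [exact: cf|exact: cg].
by apply: is_deriveD; [exact: fd|exact: gd].
Qed.

Lemma primitive_onZ a b k f df : primitive_on a b f df ->
  primitive_on a b (fun x => k * f x) (fun x => k * df x).
Proof.
move=> [cf fd]; split=> [x|x xab]; first by apply: cvgM; [exact: cvg_cst|exact: cf].
by apply: is_deriveZ; exact: fd.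
Qed.

Lemma primitive_onB a b f df g dg : primitive_on a b f df -> primitive_on a b g dg ->
  primitive_on a b (fun x => f x - g x) (fun x => df x - dg x).
Proof.
move=> [cf fd] [cg gd]; split=> [x|x xab]; first by apply: cvgB; [exact: cf|exact: cg].
by apply: is_deriveB; [exact: fd|exact: gd].
Qed.

Lemma primitive_onM a b f df g dg : primitive_on a b f df -> primitive_on a b g dg ->
  primitive_on a b (fun x => f x * g x) (fun x => f x * dg x + g x * df x).
Proof.
move=> [cf fd] [cg gd]; split=> [x|x xab]; first by apply: cvgM; [exact: cf|exact: cg].
by apply: is_deriveM; [exact: fd|exact: gd].
Qed.

Lemma primitive_on_sum a b n (h dh : nat -> R -> R) :
  (forall i, (i < n)%N -> primitive_on a b (h i) (dh i)) ->
  primitive_on a b (fun t => \sum_(i < n) h i t) (fun t => \sum_(i < n) dh i t).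
Proof.
elim: n => [|n IHn] hd.
  have -> : (fun t : R => \sum_(i < 0) h i t) = cst 0.
    by apply/funext => t; rewrite big_ord0.
  by apply: derive_primitive_on => x; rewrite big_ord0; exact: is_derive_cst.
have -> : (fun t => \sum_(i < n.+1) h i t) = (fun t => \sum_(i < n) h i t + h n t).
  by apply/funext => t; rewrite big_ord_recr.
apply: eq_primitive_on (primitive_onD (IHn _) (hd n _)) _ => // [i ni|x _].
  by apply: hd; exact: ltnW.
by rewrite big_ord_recr.
Qed.

Lemma sub_primitive_on a b a' b' f df : a <= a' -> b' <= b ->
  primitive_on a b f df -> primitive_on a' b' f df.
Proof.
move=> aa bb [cf fd]; split=> [|x xab]; last by apply: fd; lra.
by apply: continuous_subspaceW cf; move=> z /=; rewrite !in_itv /=; lra.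
Qed.

(** Stands in for monotonicity of the integral: the mean value theorem is applied to [g - f] and
    [g + f]. *)
Lemma primitive_on_le a b f df g dg : a <= b ->
  primitive_on a b f df -> primitive_on a b g dg ->
  (forall x, a < x < b -> `|df x| <= dg x) -> `|f b - f a| <= g b - g a.
Proof.
move=> ab pf pg dfg.
have key h dh : primitive_on a b h dh -> (forall x, a < x < b -> `|dh x| <= dg x) ->
    h b - h a <= g b - g a.
  move=> ph dhg; have [cgh dgh] := primitive_onB pg ph.
  move: ab; rewrite le_eqVlt => /predU1P[->|ab]; first by rewrite !subrr.
  have dgh' x : x \in `]a, b[ -> is_derive x 1 (fun x => g x - h x) (dg x - dh x).
    by rewrite in_itv; exact: dgh.
  have [c cab e] := MVT ab dgh' cgh.
  rewrite in_itv /= in cab; have := dhg c cab; have := ler_norm (dh c) => h1 h2.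
  have : 0 <= (dg c - dh c) * (b - a) by rewrite mulr_ge0 // subr_ge0; lra.
  lra.
rewrite ler_norml; apply/andP; split; last exact: key pf dfg.
have := key _ _ (primitive_onZ (-1) pf); rewrite !mulN1r => /(_ _) hk.
rewrite lerNl; apply: le_trans (hk _); first by lra.
by move=> x xab; rewrite mulN1r normrN; exact: dfg.
Qed.

Lemma primitive_on_bound a b f df K : a <= b ->
  primitive_on a b f df -> (forall x, a < x < b -> `|df x| <= K) ->
  `|f b - f a| <= K * (b - a).
Proof.
move=> ab pf dfK; have pK : primitive_on a b (fun x => K * x) (fun=> K * 1).
  by apply: primitive_onZ; apply: derive_primitive_on => x; exact: is_derive_id.
by have := primitive_on_le ab pf pK; rewrite mulrBr mulr1; apply.
Qed.

Lemma primitive_on_eq a b f g df : a <= b ->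
  primitive_on a b f df -> primitive_on a b g df -> f b - f a = g b - g a.
Proof.
move=> ab pf pg; apply/eqP; rewrite -subr_eq0 -normr_le0.
have -> : f b - f a - (g b - g a) = f b - g b - (f a - g a) by lra.
have := primitive_on_bound (K := 0) ab (primitive_onB pf pg); rewrite mul0r; apply.
by move=> x _; rewrite subrr normr0.
Qed.

(** The one place where an integral is taken; all other primitives are built from these or written
    down explicitly. *)
Lemma primitive_exists f : {within `[0, 1], continuous f} ->
  exists2 F, F 0 = 0 & primitive_on 0 1 F f.
Proof.
move=> cf; pose mu := @lebesgue_measure R.
have fi : mu.-integrable `[0, 1] (EFin \o f).
  by apply: continuous_compact_integrable => //; exact: segment_compact.
exists (fun x => parameterized_integral mu 0 x f).
  by rewrite /parameterized_integral set_itv1 Rintegral_set1.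
split=> [|x /andP[x0 x1]]; first exact: parameterized_integral_continuous.
have fx : {for x, continuous f}.
  have /(continuous_within_itvP _ ltr01)[fo _ _] := cf.
  by apply: fo; rewrite in_itv /= x0.
have [dF Fx] := @continuous_FTC1_closed R f 0 x 1 x1 fi x0 fx.
by split; [exact: dF|rewrite -derive1E; exact: Fx].
Qed.

End Primitives.

(** * Truncated sums organized by the last entry *)

Section PartialSums.
Variable R : realType.
Implicit Type kap : nat -> nat.

(* [tcoef kap r i] is the sum of [m_1^-k_1 ... m_r^-k_r] over the admissible
   tuples with last entry [m_r = r + 2 i]. *)
Fixpoint tcoef kap (r i : nat) : R :=
  if r is r'.+1 then
    ((r + i.*2)%:R ^+ kap r')^-1 * \sum_(j < i.+1) tcoef kap r' j
  else (i == 0%N)%:R.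

Lemma tcoefS kap r i : tcoef kap r.+1 i =
  ((r.+1 + i.*2)%:R ^+ kap r)^-1 * \sum_(j < i.+1) tcoef kap r j.
Proof. by []. Qed.

(** [(M.+2 - s)./2] is the number of integers from [s] to [M] with the parity of [s], and 0 once [s]
    exceeds [M]. *)
Lemma sum_same_parity M s (G : nat -> R) : (forall p, (p < s)%N -> G p = 0) ->
  \sum_(p < M.+1 | odd p == odd s) G p = \sum_(j < (M.+2 - s)./2) G (s + j.*2)%N.
Proof.
move=> G0; rewrite big_mkcond; elim: M => [|M IHM].
  rewrite big_ord1; case: s G0 => [|s] G0; first by rewrite big_ord1.
  rewrite G0 // if_same; have -> : ((2 - s.+1)./2 = 0)%N by lia.
  by rewrite big_ord0.
rewrite big_ord_recr {}IHM /=.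
have [sM|Ms] := leqP s M.+1; last first.
  rewrite G0 // if_same addr0.
  by have -> : ((M.+3 - s)./2 = (M.+2 - s)./2)%N by lia.
case: ifPn => [/eqP e|ne]; last first.
  have -> : ((M.+3 - s)./2 = (M.+2 - s)./2)%N by lia.
  by rewrite addr0.
have -> : ((M.+3 - s)./2 = (M.+2 - s)./2.+1)%N by lia.
by rewrite big_ord_recr /=; congr (_ + G _); lia.
Qed.

Definition good_tuple M r (m : r.-tuple 'I_M.+1) : bool :=
  path ltn 0%N (map (@nat_of_ord M.+1) m)
  && [forall i : 'I_r, odd (tnth m i) == odd i.+1].

Lemma tnth_rcons_widen M r (m : r.-tuple 'I_M.+1) (p : 'I_M.+1) (i : 'I_r) :
  tnth [tuple of rcons m p] (widen_ord (leqnSn r) i) = tnth m i.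
Proof. by rewrite !(tnth_nth p) /= nth_rcons size_tuple ltn_ord. Qed.

Lemma tnth_rcons_max M r (m : r.-tuple 'I_M.+1) (p : 'I_M.+1) :
  tnth [tuple of rcons m p] ord_max = p.
Proof. by rewrite (tnth_nth p) /= nth_rcons size_tuple ltnn eqxx. Qed.

Lemma good_rcons M r (m : r.-tuple 'I_M.+1) (p : 'I_M.+1) :
  good_tuple [tuple of rcons m p] =
  [&& odd p == odd r.+1, good_tuple m & (last 0 (map (@nat_of_ord M.+1) m) < p)%N].
Proof.
rewrite /good_tuple /= map_rcons rcons_path /=.
set A := path _ _ _; set B := (_ < _)%N.
have -> : [forall i, odd (tnth [tuple of rcons m p] i) == odd i.+1] =
    [forall i, odd (tnth m i) == odd i.+1] && (odd p == odd r.+1).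
  apply/forallP/andP => [H|[/forallP H Hp] i].
    split; last by have := H ord_max; rewrite tnth_rcons_max.
    by apply/forallP => i; have := H (widen_ord (leqnSn r) i); rewrite tnth_rcons_widen.
  have [ir|ri] := ltnP i r.
    have -> : i = widen_ord (leqnSn r) (Ordinal ir) by apply: val_inj.
    by rewrite tnth_rcons_widen; exact: H.
  have -> : i = ord_max by apply: val_inj; have := ltn_ord i; rewrite /=; lia.
  by rewrite tnth_rcons_max.
by case: A; case: B; rewrite ?andbF ?andbT ?andTb // andbC.
Qed.

Lemma rcons_tuple_bij (T : finType) r :
  bijective (fun x : r.-tuple T * T => [tuple of rcons x.1 x.2]).
Proof.
apply: inj_card_bij; last by rewrite card_prod !card_tuple expnSr.
move=> [m p] [m' p'] /(congr1 val) /= /rcons_inj [e ->]; congr (_, _).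
exact: val_inj.
Qed.

(** The weight [h] carries the induction: once a new last entry [p] is fixed, the condition that the
    previous one be smaller is again a weight, the indicator of [q < p]. *)
Lemma sum_good_tuples kap M r (h : nat -> R) :
  \sum_(m : r.-tuple 'I_M.+1 | good_tuple m)
    h (last 0%N (map (@nat_of_ord M.+1) m)) * \prod_(i < r) ((tnth m i)%:R ^+ kap i)^-1
  = \sum_(i < (M.+2 - r)./2) h (r + i.*2)%N * tcoef kap r i.
Proof.
elim: r h => [|r IHr] h.
  rewrite (big_pred1 [tuple]) => [|m]; last first.
    rewrite (tuple0 m) [RHS]eqxx /good_tuple /=; by apply/forallP => -[].
  by rewrite /= big_ord0 mulr1 big_ord_recl /= mulr1 big1 ?addr0 // => i _; rewrite mulr0.
rewrite (reindex _ (onW_bij _ (rcons_tuple_bij _ _))) /=.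
rewrite (eq_bigl (fun x : r.-tuple 'I_M.+1 * 'I_M.+1 => [&& odd x.2 == odd r.+1, good_tuple x.1
  & (last 0 (map (@nat_of_ord M.+1) x.1) < x.2)%N])); last first.
  by move=> [m p]; rewrite /= good_rcons.
pose G (m : r.-tuple 'I_M.+1) (p : 'I_M.+1) : R :=
  (if odd p == odd r.+1 then h p * ((p%:R ^+ kap r)^-1) else 0) *
  (if good_tuple m then (last 0 (map (@nat_of_ord M.+1) m) < p)%N%:R *
     \prod_(i < r) ((tnth m i)%:R ^+ kap i)^-1 else 0).
rewrite big_mkcond (eq_bigr (fun x => G x.1 x.2)); last first.
  move=> [m p] _; rewrite /G /= map_rcons last_rcons big_ord_recr /=.
  rewrite tnth_rcons_max; under eq_bigr do rewrite tnth_rcons_widen.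
  case: (odd p == _); last by rewrite mul0r.
  case: (good_tuple m); last by rewrite mulr0.
  case: (_ < _)%N; last by rewrite mul0r mulr0.
  by rewrite mul1r -mulrA [X in h p * X]mulrC.
rewrite -(pair_bigA _ G) exchange_big /G /=.
under eq_bigr => p _ do rewrite -mulr_sumr -big_mkcond /= (IHr (fun q => (q < p)%N%:R)).
pose G' p : R := (h p * (p%:R ^+ kap r)^-1) *
  \sum_(i < (M.+2 - r)./2) (r + i.*2 < p)%N%:R * tcoef kap r i.
rewrite (eq_bigr (fun p : 'I_M.+1 => if odd p == odd r.+1 then G' p else 0)); last first.
  by move=> p _; case: ifP; rewrite ?mul0r.
rewrite -big_mkcond sum_same_parity => [|p pr]; last first.
  rewrite /G' big1 ?mulr0 // => i _; have -> : (r + i.*2 < p)%N = false by lia.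
  by rewrite mul0r.
apply: eq_bigr => j _; rewrite /G' -mulrA; congr (_ * (_ * _)).
have jM : (j.+1 <= (M.+2 - r)./2)%N by have := ltn_ord j; lia.
rewrite (big_ord_widen _ (fun i => tcoef kap r i) jM) [RHS]big_mkcond.
apply: eq_bigr => i _; have -> : (r + i.*2 < r.+1 + j.*2)%N = (i < j.+1)%N by lia.
by case: ltnP; rewrite ?mul1r ?mul0r.
Qed.

Lemma T_partialE (k : seq nat) M : T_partial R k M =
  2 ^+ size k * \sum_(i < (M.+2 - size k)./2) tcoef (nth 0%N k) (size k) i.
Proof.
congr (_ * _); have := sum_good_tuples (nth 0%N k) M (size k) (fun=> 1).
under eq_bigr do rewrite mul1r.
by under [X in _ = X -> _]eq_bigr do rewrite mul1r.
Qed.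

Lemma Ttilde_partialE (k : seq nat) M : Ttilde_partial R k M =
  2 ^+ size k * \sum_(i < (M.+2 - size k)./2) (-1) ^+ i * tcoef (nth 0%N k) (size k) i.
Proof.
congr (_ * _).
have := sum_good_tuples (nth 0%N k) M (size k) (fun p => (-1) ^+ (p - size k)./2).
by under [X in _ = X -> _]eq_bigr do rewrite addKn doubleK.
Qed.

Lemma tcoef_ge0 kap r i : 0 <= tcoef kap r i.
Proof.
elim: r i => [|r IHr] i /=; first exact: ler0n.
by rewrite mulr_ge0 ?invr_ge0 ?exprn_ge0 // sumr_ge0.
Qed.

Lemma eq_tcoef kap kap' r i : (forall q, (q < r)%N -> kap q = kap' q) ->
  tcoef kap r i = tcoef kap' r i.
Proof.
elim: r i => //= r IHr i e; rewrite e //; congr (_ * _).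
by apply: eq_bigr => j _; apply: IHr => q qr; apply: e; exact: ltnW.
Qed.

(* Cesaro's lemma, applied to [sum_(j < i.+1) tcoef kap r j / (r.+1 + 2 i)]. *)
Lemma sum_tcoef_small kap r : (forall q, (q < r)%N -> (0 < kap q)%N) ->
  (fun N => N.+1%:R^-1 * \sum_(j < N.+1) tcoef kap r j) @ \oo --> (0 : R).
Proof.
elim: r => [|r IHr] kap_gt0.
  have -> : (fun N => N.+1%:R^-1 * \sum_(j < N.+1) tcoef kap 0 j) = @harmonic R.
    apply/funext => N; rewrite big_ord_recl /= big1 ?addr0 ?mulr1 // => i _.
  exact: cvg_harmonic.
have /cesaro := IHr (fun q qr => kap_gt0 q (ltnW qr)).
rewrite /arithmetic_mean => lim0.
apply: squeeze_cvgr (cvg_cst 0) lim0; near=> N; apply/andP; split.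
  by rewrite mulr_ge0 ?invr_ge0 // sumr_ge0 // => i _; exact: tcoef_ge0.
rewrite /= ler_wpM2l ?invr_ge0 // seriesEord /= ler_sum // => i _.
rewrite ler_wpM2r ?sumr_ge0 // => [j _|]; first exact: tcoef_ge0.
rewrite lef_pV2 ?posrE ?exprn_gt0 ?ltr0n ?addSn //.
rewrite -natrX ler_nat (leq_trans _ (leq_pexp2l _ (kap_gt0 r (ltnSn r)))) //.
by rewrite expn1; lia.
Unshelve. all: by end_near. Qed.

End PartialSums.

(** * Generating polynomials and their limits *)

Section TildePolynomials.
Variable R : realType.
Implicit Types (kap : nat -> nat) (x : R) (F G : R -> R).

Definition theta x : R := 2 * atan x.
Definition dtheta x : R := 2 / (1 + x ^+ 2).

Lemma is_derive_theta x : is_derive x 1 theta (dtheta x).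
Proof. by apply: is_deriveZ. Qed.

Lemma continuous_theta : continuous theta.
Proof. by move=> x; exact: is_derive_continuous (is_derive_theta x). Qed.

Lemma theta0 : theta 0 = 0.
Proof. by rewrite /theta atan0 mulr0. Qed.

Lemma theta1 : theta 1 = pi / 2.
Proof. by rewrite /theta atan1; field. Qed.

Lemma dtheta_gt0 x : 0 < dtheta x.
Proof. by rewrite /dtheta divr_gt0 // ltr_pwDl // sqr_ge0. Qed.

Lemma dtheta_le2 x : dtheta x <= 2.
Proof. by rewrite /dtheta ler_pdivrMr ?ltr_pwDl ?sqr_ge0 //; have := sqr_ge0 x; lra. Qed.

Lemma theta_gt0 x : 0 < x -> 0 < theta x.
Proof. by move=> x0; rewrite /theta mulr_gt0 // -(atan0 R) lt_atan. Qed.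

Lemma theta_lt x : x < 1 -> theta x < pi / 2.
Proof. by move=> x1; rewrite -theta1 /theta ltr_pM2l // lt_atan. Qed.

Lemma theta_le2 x : 0 <= x -> theta x <= 2 * x.
Proof.
move=> x0; have := primitive_on_bound x0 (derive_primitive_on 0 x is_derive_theta) (K := 2).
rewrite theta0 !subr0 => h; apply: le_trans (ler_norm _) (h _).
by move=> t _; rewrite gtr0_norm ?dtheta_gt0 // dtheta_le2.
Qed.

(** The Caratheodory form of the derivative at 0 extends [theta x / x] continuously; this makes the
    innermost integrand of [primitive_chain] continuous. *)
Lemma theta_quotient : exists2 q : R -> R, continuous q & forall x, theta x = q x * x.
Proof.
have [g [gE g0 _]] := (is_derive1_caratheodory theta 0 (dtheta 0)).1 (is_derive_theta 0).
exists g => x; last by have := gE x; rewrite theta0 !subr0.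
have [->|x0] := eqVneq x 0; first exact: g0.
have gx t : t != 0 -> g t = theta t / t.
  by move=> t0; have := gE t; rewrite theta0 !subr0 => ->; rewrite mulfK.
have : (fun t => theta t / t) @ x --> theta x / x.
  by apply: cvgM; [exact: continuous_theta|apply: cvgV].
rewrite /continuous_at gx //; apply: cvg_trans; apply: near_eq_cvg.
by near=> t; rewrite gx //; near: t; exact: (cvgr_neq0 x).
Unshelve. all: by end_near. Qed.

(** At [x = 1] this is a partial sum of the [Ttilde] series. The exponent of [x] is the last entry
    [m_r], so differentiation lowers [k_r] by one, up to a factor [x]. *)
Definition tpoly kap r N x : R :=
  2 ^+ r * \sum_(i < N) (-1) ^+ i * tcoef R kap r i * x ^+ (r + i.*2).

Lemma tpoly0 kap r N : tpoly kap r.+1 N 0 = 0.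
Proof.
by rewrite /tpoly big1 ?mulr0 // => i _; rewrite addSn expr0n mulr0.
Qed.

Lemma is_derive_tpoly kap r N x : is_derive x 1 (tpoly kap r.+1 N)
  (2 ^+ r.+1 * \sum_(i < N) (-1) ^+ i * tcoef R kap r.+1 i
     * ((r.+1 + i.*2)%:R * x ^+ (r + i.*2))).
Proof.
apply: is_deriveZ.
pose h i t : R := (-1) ^+ i * tcoef R kap r.+1 i * t ^+ (r.+1 + i.*2).
pose dh i t : R := (-1) ^+ i * tcoef R kap r.+1 i
     * ((r.+1 + i.*2)%:R * t ^+ (r + i.*2)).
apply: (@is_derive_sum_fun R N h dh) => i _; apply: is_deriveZ.
exact: is_derive_exprn.
Qed.

(** Abel summation: the factor [1 + x^2] turns the partial sums of [tcoef R kap r] in the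
    differentiated coefficients back into single terms, at the price of a boundary term. *)
Lemma is_derive_tpoly1 kap r N x : kap r = 1%N ->
  is_derive x 1 (tpoly kap r.+1 N) (dtheta x * (tpoly kap r N x -
    2 ^+ r * (-1) ^+ N * (\sum_(j < N) tcoef R kap r j) * x ^+ (r + N.*2))).
Proof.
move=> k1; apply: is_derive_eq (is_derive_tpoly kap r N x) _.
rewrite /tpoly exprS /dtheta.
have x2 : 1 + x ^+ 2 != 0 by rewrite gt_eqF // ltr_pwDl // sqr_ge0.
apply: (mulIf x2); rewrite [RHS]mulrAC -[2 / _ * _]mulrA mulVf // mulr1.
rewrite -!mulrA; congr (_ * _); rewrite -mulrBr; congr (_ * _).
elim: N => [|N IHN]; first by rewrite !big_ord0 !mul0r mulr0 subr0.
rewrite !big_ord_recr mulrDl {}IHN tcoefS k1 expr1 big_ord_recr /=.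
have rN : (r.+1 + N.*2)%:R != 0 :> R by rewrite pnatr_eq0 addSn.
rewrite doubleS !addnS [x ^+ (r + N.*2).+2]exprSr [x ^+ (r + N.*2).+1]exprSr.
rewrite [(-1) ^+ N.+1]exprS.
move: (_%:R) rN (x ^+ (r + _)) ((-1) ^+ N) (tcoef R kap r N) => n n0 X S c.
move: (\sum_(j < N) _) (\sum_(i < N) _) => A C.
by field.
Qed.

Definition uniform_limit kap r F := forall e : R, 0 < e ->
  exists N0, forall N x, (N0 <= N)%N -> 0 <= x <= 1 -> `|tpoly kap r N x - F x| <= e.

(* The factor [x] makes the estimate survive a division by [x]. *)
Definition strong_limit kap r F := forall e : R, 0 < e ->
  exists N0, forall N x, (N0 <= N)%N -> 0 <= x <= 1 -> `|tpoly kap r N x - F x| <= e * x.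

Lemma strong_uniform_limit kap r F : strong_limit kap r F -> uniform_limit kap r F.
Proof.
move=> h e e0; have [N0 hN] := h e e0; exists N0 => N x N0N x01.
by apply: le_trans (hN N x N0N x01) _; rewrite ler_piMr ?(ltW e0) //; case/andP: x01.
Qed.

(** The boundary term of [is_derive_tpoly1] need not be small near [x = 1], but its integral is:
    integration divides by the exponent [(r + N.*2).+1], while the sum of coefficients is [o(N)] by
    [sum_tcoef_small]. *)
Lemma strong_limitS kap r F G : (forall q, (q < r)%N -> (0 < kap q)%N) -> kap r = 1%N ->
  uniform_limit kap r F -> G 0 = 0 -> primitive_on 0 1 G (fun x => dtheta x * F x) ->
  strong_limit kap r.+1 G.
Proof.
move=> kap0 k1 limF G0 pG e e0.
have [N1 hN1] := limF (e / 4) ltac:(lra).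
have /cvgrPdist_le/(_ (e / (4 * 2 ^+ r))) := sum_tcoef_small (R := R) kap0.
case=> [|N2 _ hN2]; first by rewrite divr_gt0 // mulr_gt0 // exprn_gt0.
exists (maxn N1 N2) => N x; rewrite geq_max => /andP[N1N N2N] /andP[x0 x1].
have {hN1} hN1 := hN1 N _ N1N; have {hN2} hN2 := hN2 N N2N.
set C := \sum_(j < N) tcoef R kap r j.
have C0 : 0 <= C by rewrite sumr_ge0 // => i _; exact: tcoef_ge0.
have CN : 2 ^+ r * C <= e / 4 * N.+1%:R.
  move: hN2; rewrite sub0r normrN ger0_norm; last first.
    by rewrite mulr_ge0 ?invr_ge0 // sumr_ge0 // => i _; exact: tcoef_ge0.
  rewrite mulrC ler_pdivrMr // => hN2.
  have : C <= e / (4 * 2 ^+ r) * N.+1%:R.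
    by apply: le_trans hN2; rewrite big_ord_recr /= lerDl tcoef_ge0.
  have p2 : 0 < 2 ^+ r :> R by rewrite exprn_gt0.
  rewrite -(ler_pM2l p2) => /le_trans; apply; rewrite le_eqVlt; apply/orP; left; apply/eqP.
  by field; rewrite gt_eqF.
pose B := 2 ^+ r * C; have B0 : 0 <= B by rewrite mulr_ge0 ?exprn_ge0.
(* The majorant uses [dtheta t <= 2]: the error of [F] contributes [2 * (e / 4)] to the derivative,
   and the boundary term integrates to at most [e / 2 * x] by [CN]. *)
pose g t : R := e / 2 * t + 2 * B / (r + N.*2).+1%:R * t ^+ (r + N.*2).+1.
pose dg t : R := e / 2 + 2 * B * t ^+ (r + N.*2).
have pg : primitive_on 0 x g dg.
  apply: derive_primitive_on => t; apply: is_deriveD.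
    by rewrite -[X in is_derive _ _ _ X]mulr1; apply: is_deriveZ; exact: is_derive_id.
  apply: is_derive_eq (is_deriveZ _ (is_derive_exprn _ t)) _.
  have : (r + N.*2).+1%:R != 0 :> R by rewrite pnatr_eq0.
  by rewrite /GRing.scale /=; move: (_.+1%:R) => n n0; field.
have pE := primitive_onB (derive_primitive_on 0 x (fun t => is_derive_tpoly1 N t k1))
  (sub_primitive_on (lexx 0) x1 pG).
have := primitive_on_le x0 pE pg; rewrite tpoly0 G0 !subr0 => /(_ _)/le_trans; apply.
  move=> t /andP[t0 tx]; have t1 : 0 <= t <= 1 by lra.
  rewrite -mulrBr normrM gtr0_norm ?dtheta_gt0 // -/C /dg.
  have := hN1 t t1; set E := tpoly _ _ _ _ - _ => hE.
  have -> : tpoly kap r N t - 2 ^+ r * (-1) ^+ N * C * t ^+ (r + N.*2) - F t =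
     E - (-1) ^+ N * (B * t ^+ (r + N.*2)) by rewrite /E /B; ring.
  have Bt : 0 <= B * t ^+ (r + N.*2) by rewrite mulr_ge0 ?exprn_ge0 // ltW.
  apply: (@le_trans _ _ (2 * (e / 4 + B * t ^+ (r + N.*2)))); last first.
    by rewrite mulrDr [2 * (B * _)]mulrA lerD2r; lra.
  apply: ler_pM => //; [exact: ltW (dtheta_gt0 _)|exact: dtheta_le2|].
  apply: le_trans (ler_normB _ _) _; apply: lerD => //.
  by rewrite normrM normrX normrN1 expr1n mul1r ger0_norm.
have -> : g 0 = 0 by rewrite /g mulr0 add0r expr0n mulr0.
rewrite subr0 /g.
have : 2 * B / (r + N.*2).+1%:R * x ^+ (r + N.*2).+1 <= e / 2 * x; last first.
  have -> : e * x = e / 2 * x + e / 2 * x by rewrite -mulrDl -splitr.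
  by rewrite lerD2l.
apply: ler_pM => //; rewrite ?exprn_ge0 ?mulr_ge0 ?invr_ge0 //.
  rewrite ler_pdivrMr //; apply: (@le_trans _ _ (e / 2 * N.+1%:R)).
    by rewrite /B; lra.
  by rewrite ler_pM2l ?ler_nat; [lia|lra].
by rewrite exprS ler_piMr // exprn_ile1.
Qed.

(** Lowering the last exponent from 2 to 1 is the operator [x d/dx], so the derivative of the new
    error is the error of [F] divided by [x]; the bound [e * x] absorbs this division. *)
Lemma strong_limit_quotient kap kap' r F G :
  (forall q, (q < r)%N -> kap q = kap' q) -> kap r = 2%N -> kap' r = 1%N ->
  strong_limit kap' r.+1 F -> G 0 = 0 -> primitive_on 0 1 G (fun x => F x / x) ->
  strong_limit kap r.+1 G.
Proof.
move=> kk k2 k1 limF G0 pG e e0; have [N0 hN0] := limF e e0.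
exists N0 => N x N0N /andP[x0 x1].
have pE := primitive_onB (derive_primitive_on 0 x (is_derive_tpoly kap r N))
  (sub_primitive_on (lexx 0) x1 pG).
have := primitive_on_bound x0 pE (K := e); rewrite tpoly0 G0 !subr0; apply.
move=> t /andP[t0 tx].
have -> : 2 ^+ r.+1 * (\sum_(i < N) (-1) ^+ i * tcoef R kap r.+1 i *
    ((r.+1 + i.*2)%:R * t ^+ (r + i.*2))) - F t / t = (tpoly kap' r.+1 N t - F t) / t.
  rewrite mulrBl; congr (_ - _); rewrite /tpoly -mulrA; congr (_ * _).
  rewrite mulr_suml; apply: eq_bigr => i _.
  rewrite !tcoefS k1 k2 (eq_bigr (fun j : 'I_i.+1 => tcoef R kap' r j)); last first.
    by move=> j _; exact: eq_tcoef.
  have rN : (r.+1 + i.*2)%:R != 0 :> R by rewrite pnatr_eq0 addSn.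
  have tn : t != 0 by rewrite gt_eqF.
  rewrite [t ^+ (r.+1 + _)]exprS expr1; move: (_%:R) rN => n n0.
  by field; rewrite tn n0.
by rewrite normrM normfV (gtr0_norm t0) ler_pdivrMr // hN0 //; lra.
Qed.

Lemma strong_limit_ones r :
  strong_limit (fun=> 1%N) r.+1 (fun x => theta x ^+ r.+1 / r.+1`!%:R).
Proof.
have step n : uniform_limit (fun=> 1%N) n (fun x => theta x ^+ n / n`!%:R) ->
    strong_limit (fun=> 1%N) n.+1 (fun x => theta x ^+ n.+1 / n.+1`!%:R).
  move=> lim_n; apply: strong_limitS lim_n _ _ => //.
    by rewrite theta0 expr0n mul0r.
  apply: derive_primitive_on => x.
  have -> : (fun x => theta x ^+ n.+1 / n.+1`!%:R) =
      (fun x => n.+1`!%:R^-1 * theta x ^+ n.+1) by apply/funext => t; rewrite mulrC.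
  apply: is_derive_eq (is_deriveZ _ (is_derive_expr _ (is_derive_theta x))) _.
  rewrite /GRing.scale /= factS natrM.
  have : n.+1%:R != 0 :> R by rewrite pnatr_eq0.
  have : n`!%:R != 0 :> R by rewrite pnatr_eq0 -lt0n fact_gt0.
  by move: (n.+1%:R) (n`!%:R) => p q p0 q0; field; rewrite p0 q0.
elim: r => [|r IHr]; apply: step; last exact: strong_uniform_limit.
(* In depth 0 only the term [i = 0] is nonzero, so the polynomial equals 1 as soon as [0 < N]. *)
move=> e e0; exists 1%N => -[//|N] x _ _.
rewrite /tpoly big_ord_recl big1 => [|i _]; last by rewrite /= mulr0 mul0r.
by rewrite /= fact0 divr1 !expr0 !mul1r addr0 subrr normr0 ltW.
Qed.

End TildePolynomials.

(** * The [Ttilde] values as single integrals *)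

Section TildeValue.
Variable R : realType.

Lemma primitive_chain a : exists G : nat -> R -> R,
  [/\ forall j, G j 0 = 0,
      primitive_on 0 1 (G 0%N) (fun x => theta x ^+ a.+1 / a.+1`!%:R / x) &
      forall j, primitive_on 0 1 (G j.+1) (fun x => dtheta x * G j x)].
Proof.
pose prim (f : R -> R) : R -> R :=
  xget (cst 0) [set F | F 0 = 0 /\ primitive_on 0 1 F f].
have primP (f : R -> R) : {within `[0, 1], continuous f} ->
    prim f 0 = 0 /\ primitive_on 0 1 (prim f) f.
  by move=> /primitive_exists[F F0 pF]; rewrite /prim; case: xgetP => [_ -> //|/(_ F)[]].
have [q cq qE] := @theta_quotient R.
(* The integrand of [G 0], with one factor [theta x / x] replaced by its continuous extension. *)
pose f0 x : R := theta x ^+ a / a.+1`!%:R * q x.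
have cf0 : {within `[0, 1], continuous f0}.
  apply: continuous_subspaceT => x; apply: cvgM; last exact: cq.
  apply: cvgM; last exact: cvg_cst.
  exact: is_derive_continuous (is_derive_expr a (is_derive_theta x)).
pose G := fix G j := if j is j'.+1 then prim (fun x => dtheta x * G j' x) else prim f0.
have cdt : continuous (@dtheta R).
  move=> x; have dx : is_derive x 1 (fun t : R => 1 + t ^+ 2) (0 + 2%:R * x ^+ 1).
    exact: is_deriveD (is_derive_cst (1 : R) x (1 : R)) (is_derive_exprn 2 x).
  apply: cvgM; first exact: cvg_cst.
  apply: cvgV; first by rewrite gt_eqF // ltr_pwDl // sqr_ge0.
  exact: is_derive_continuous dx.
have GP j : G j 0 = 0 /\ {within `[0, 1], continuous (G j)}.
  elim: j => [|j [_ cG]]; first by have [? []] := primP _ cf0.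
  suff /primP[? []] : {within `[0, 1], continuous (fun x => dtheta x * G j x)} by [].
  by move=> x; apply: cvgM; [apply: (continuous_subspaceT cdt)|exact: cG].
exists G; split=> [j| |j]; first by have [] := GP j.
  have [_ p0] := primP _ cf0; apply: eq_primitive_on p0 _ => x /andP[x0 _].
  have xn : x != 0 by rewrite gt_eqF.
  have fn : a.+1`!%:R != 0 :> R by rewrite pnatr_eq0 -lt0n fact_gt0.
  rewrite /f0 exprSr; move: (theta x ^+ a) (_%:R) fn => u v v0.
  by rewrite qE; field; rewrite xn.
apply: (primP _ _).2 => x.
by apply: cvgM; [apply: (continuous_subspaceT cdt)|exact: (GP j).2].
Qed.

Definition two_at (a q : nat) : nat := if q == a then 2 else 1.

Lemma strong_limit_chain a (G : nat -> R -> R) : (forall j, G j 0 = 0) ->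
  primitive_on 0 1 (G 0%N) (fun x => theta x ^+ a.+1 / a.+1`!%:R / x) ->
  (forall j, primitive_on 0 1 (G j.+1) (fun x => dtheta x * G j x)) ->
  forall j, strong_limit (two_at a) (a.+1 + j) (G j).
Proof.
move=> G0 p0 pS; elim=> [|j IHj].
  rewrite addn0.
  apply: (@strong_limit_quotient R (two_at a) (fun=> 1%N) a _ _ _ _ _
    (@strong_limit_ones R a) (G0 0%N) p0) => //.
    by move=> q qa; rewrite /two_at ltn_eqF.
  by rewrite /two_at eqxx.
rewrite addnS; apply: (strong_limitS _ _ (strong_uniform_limit IHj) (G0 _) (pS _)).
  by move=> q _; rewrite /two_at; case: ifP.
by rewrite /two_at gtn_eqF // addSn ltnS leq_addr.
Qed.

Definition index_2_1s a b : seq nat := nseq a 1%N ++ 2%N :: nseq b 1%N.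

Lemma Ttilde_limit a b (G : R -> R) : strong_limit (two_at a) (a.+1 + b) G ->
  Ttilde R (index_2_1s a b) = G 1.
Proof.
move=> limG; have szk : size (index_2_1s a b) = (a.+1 + b)%N.
  by rewrite size_cat /= !size_nseq addnS.
have nthk q : (q < a.+1 + b)%N -> nth 0%N (index_2_1s a b) q = two_at a q.
  move=> qab; rewrite nth_cat size_nseq /two_at.
  have [qa|aq] := ltnP q a; first by rewrite nth_nseq qa ltn_eqF.
  have [->|nqa] := eqVneq q a; first by rewrite subnn.
  have -> : (q - a = (q - a.+1).+1)%N by lia.
  by rewrite /= nth_nseq; case: ltnP => //; lia.
apply/cvg_lim => //; apply/cvgrPdist_le => e e0.
have [N0 hN] := limG e e0; near=> M.
have NM : (N0 <= (M.+2 - (a.+1 + b))./2)%N.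
  have : (N0.*2 + (a.+1 + b) <= M)%N by near: M; exact: nbhs_infty_ge.
  lia.
have := hN _ 1 NM; rewrite mulr1 ler01 lexx => /(_ isT).
rewrite distrC Ttilde_partialE szk /tpoly.
under eq_bigr do rewrite expr1n mulr1.
by under [X in _ -> `|_ - _ * X| <= _]eq_bigr do rewrite (eq_tcoef _ _ nthk).
Unshelve. all: by end_near. Qed.

(** Cauchy's formula for repeated integration in the variable [theta]: the last [b] integrations
    collapse into the kernel [v b]. Every [v n] with [0 < n] vanishes at [x = 1], so only [G b]
    survives there. *)
Lemma Ttilde_primitive a b : exists S : R -> R,
  [/\ S 0 = 0, primitive_on 0 1 S (fun x => theta x ^+ a.+1 / a.+1`!%:R
        * ((pi / 2 - theta x) ^+ b / b`!%:R) / x) &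
      Ttilde R (index_2_1s a b) = S 1].
Proof.
have [G [G0 p0 pS]] := primitive_chain a.
rewrite (Ttilde_limit (strong_limit_chain G0 p0 pS b)).
pose v n x : R := (pi / 2 - theta x) ^+ n / n`!%:R.
have dv n (x : R) : is_derive x 1 (v n.+1) (- (dtheta x * v n x)).
  have dy : is_derive x 1 (fun t : R => pi / 2 - theta t) (0 - dtheta x).
    exact: is_deriveB (is_derive_cst (pi / 2 : R) x (1 : R)) (is_derive_theta x).
  have -> : v n.+1 = (fun t => n.+1`!%:R^-1 * (pi / 2 - theta t) ^+ n.+1).
    by apply/funext => t; rewrite mulrC.
  apply: is_derive_eq (is_deriveZ _ (is_derive_expr n.+1 dy)) _.
  rewrite /GRing.scale /= factS natrM /v.
  have : n.+1%:R != 0 :> R by rewrite pnatr_eq0.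
  have : n`!%:R != 0 :> R by rewrite pnatr_eq0 -lt0n fact_gt0.
  by move: (n.+1%:R) (n`!%:R) => p q p0' q0; field; rewrite p0' q0.
have v1 n : v n 1 = (n == 0%N)%:R.
  by rewrite /v theta1 subrr expr0n; case: n => [|n]; rewrite /= ?fact0 ?divr1 ?mul0r.
(* The derivative of [sum_j G_j v_(b - j)] telescopes. *)
have tele n : primitive_on 0 1 (fun x => \sum_(j < n.+1) G j x * v (n - j)%N x)
    (fun x => theta x ^+ a.+1 / a.+1`!%:R * v n x / x).
  pose h j x := G j x * v (n - j)%N x.
  pose c j x : R := if j is j'.+1 then dtheta x * (G j' x * v (n - j)%N x)
                else theta x ^+ a.+1 / a.+1`!%:R / x * v n x.
  pose c' j x : R := if (j < n)%N then dtheta x * (G j x * v (n - j.+1)%N x) else 0.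
  have ph j : (j < n.+1)%N -> primitive_on 0 1 (h j) (fun x => c j x - c' j x).
    move=> jn; have pv : primitive_on 0 1 (v (n - j)%N)
        (fun x => if (j < n)%N then - (dtheta x * v (n - j.+1)%N x) else 0).
      apply: derive_primitive_on => x; case: ltnP => [jn'|nj].
        by have -> : (n - j = (n - j.+1).+1)%N by lia.
      have -> : (n - j = 0)%N by lia.
      have -> : v 0%N = cst 1 by apply/funext => t; rewrite /v expr0 fact0 divr1.
      exact: is_derive_cst.
    case: j jn pv => [|j] jn pv.
      apply: eq_primitive_on (primitive_onM p0 pv) _ => x _.
      by rewrite /c /c' subn0; case: ifP => _; ring.
    apply: eq_primitive_on (primitive_onM (pS j) pv) _ => x _.
    by rewrite /c /c'; case: ifP => _; ring.
  apply: eq_primitive_on (primitive_on_sum ph) _ => x _.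
  rewrite big_split sumrN /= big_ord_recl [X in _ - X]big_ord_recr /=.
  rewrite {2}/c' ltnn addr0 [X in _ - X](eq_bigr (fun i : 'I_n => c (lift ord0 i) x)).
    by rewrite addrK /c; ring.
  by move=> i _; rewrite /c' ltn_ord.
exists (fun x => \sum_(j < b.+1) G j x * v (b - j)%N x); split; last 1 first.
- rewrite big_ord_recr /= subnn v1 mulr1 big1 ?add0r // => i _.
  by rewrite v1 subn_eq0 leqNgt ltn_ord mulr0.
- by rewrite big1 // => i _; rewrite G0 mul0r.
- exact: tele.
Qed.

End TildeValue.

(** * Trigonometric sums and the Fourier series of a linear function *)

Section SineSeries.
Variable R : realType.
Implicit Types (x y z c : R) (p N : nat).

Lemma is_derive_sinZ c y : is_derive y 1 (fun t => sin (c * t)) (c * cos (c * y)).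
Proof.
have dc : is_derive y 1 (fun t => c * t) (c * 1) by apply: is_deriveZ; exact: is_derive_id.
apply: is_derive_eq (is_derive1_comp (is_derive_sin (c * y)) dc) _.
by rewrite mulr1 mulrC.
Qed.

Lemma is_derive_cosZ c y : is_derive y 1 (fun t => cos (c * t)) (- (c * sin (c * y))).
Proof.
have dc : is_derive y 1 (fun t => c * t) (c * 1) by apply: is_deriveZ; exact: is_derive_id.
apply: is_derive_eq (is_derive1_comp (is_derive_cos (c * y)) dc) _.
by rewrite mulr1 mulrC mulrN.
Qed.

Lemma cos_odd_pihalf i : cos (i.*2.+1%:R * (pi / 2)) = 0 :> R.
Proof.
have -> : i.*2.+1%:R * (pi / 2) = pi / 2 + pi *+ i :> R.
  by rewrite -natr1 -muln2 natrM -[pi *+ i]mulr_natr; field.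
by rewrite (alternatingn (@cosDpi R)) cos_pihalf mulr0.
Qed.

Lemma sin_odd_pihalf i : sin (i.*2.+1%:R * (pi / 2)) = (-1) ^+ i :> R.
Proof.
have -> : i.*2.+1%:R * (pi / 2) = pi / 2 + pi *+ i :> R.
  by rewrite -natr1 -muln2 natrM -[pi *+ i]mulr_natr; field.
by rewrite (alternatingn (@sinDpi R)) sin_pihalf mulr1.
Qed.

Lemma sum_cos_odd N z :
  2 * sin z * \sum_(i < N) cos (i.*2.+1%:R * z) = sin ((2 * N)%:R * z).
Proof.
elim: N => [|N IHN]; first by rewrite big_ord0 mulr0 muln0 mul0r sin0.
rewrite big_ord_recr mulrDr {}IHN /=.
have -> : (2 * N)%:R * z = N.*2.+1%:R * z - z.
  by rewrite -natr1 mul2n; ring.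
have -> : (2 * N.+1)%:R * z = N.*2.+1%:R * z + z.
  by rewrite mul2n doubleS -[N.*2.+2%:R]natr1; ring.
by rewrite sinB sinD; ring.
Qed.

Definition frq (i : nat) : R := 2 * i.*2.+1%:R.

Lemma frq_gt0 i : 0 < frq i.
Proof. by rewrite mulr_gt0. Qed.

Definition sin_sum p N y : R := \sum_(i < N) (frq i ^+ p)^-1 * sin (frq i * y).
Definition cos_sum p N y : R := \sum_(i < N) (frq i ^+ p)^-1 * cos (frq i * y).

Lemma is_derive_sin_sum p N y : is_derive y 1 (sin_sum p.+1 N) (cos_sum p N y).
Proof.
pose h i t : R := (frq i ^+ p.+1)^-1 * sin (frq i * t).
pose dh i t : R := (frq i ^+ p)^-1 * cos (frq i * t).
apply: (@is_derive_sum_fun R N h dh) => i _; apply: is_derive_eq (is_deriveZ _ (is_derive_sinZ _ _)) _.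
rewrite /GRing.scale /= exprS /dh.
have f0 : frq i != 0 by rewrite gt_eqF // frq_gt0.
by field; rewrite expf_neq0 ?f0.
Qed.

Lemma is_derive_cos_sum p N y : is_derive y 1 (cos_sum p.+1 N) (- sin_sum p N y).
Proof.
rewrite /sin_sum -sumrN.
pose h i t : R := (frq i ^+ p.+1)^-1 * cos (frq i * t).
pose dh i t : R := - ((frq i ^+ p)^-1 * sin (frq i * t)).
apply: (@is_derive_sum_fun R N h dh) => i _; apply: is_derive_eq (is_deriveZ _ (is_derive_cosZ _ _)) _.
rewrite /GRing.scale /= exprS /dh.
have f0 : frq i != 0 by rewrite gt_eqF // frq_gt0.
by field; rewrite expf_neq0 ?f0.
Qed.

Lemma sum_cos_frq N y : sin (2 * y) * cos_sum 0 N y = sin ((4 * N)%:R * y) / 2.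
Proof.
have -> : (4 * N)%:R * y = (2 * N)%:R * (2 * y) by rewrite !natrM; ring.
rewrite -sum_cos_odd; have -> : cos_sum 0 N y = \sum_(i < N) cos (i.*2.+1%:R * (2 * y)).
  by apply: eq_bigr => i _; rewrite expr0 invr1 mul1r /frq mulrCA mulrA.
by field.
Qed.

Lemma sin_sum0 p N : sin_sum p N 0 = 0.
Proof. by rewrite /sin_sum big1 // => i _; rewrite mulr0 sin0 mulr0. Qed.

Lemma sin_sum_pihalf p N : sin_sum p N (pi / 2) = 0.
Proof.
rewrite /sin_sum big1 // => i _.
have -> : frq i * (pi / 2) = 0 + pi *+ i.*2.+1.
  by rewrite /frq -[pi *+ _]mulr_natr; field.
by rewrite (alternatingn (@sinDpi R)) sin0 !mulr0.
Qed.

Lemma pi_le4 : pi <= 4 :> R.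
Proof. by have [/andP[_]] := pihalf_02_cos_pihalf R; lra. Qed.

(* The error in the Fourier series of a linear function, up to scaling. *)
Definition linear_error N y : R := pi / 2 * (pi / 2 - 2 * y) / 2 - 4 * cos_sum 2 N y.
Definition const_error N y : R := 4 * sin_sum 1 N y - pi / 2.

Lemma is_derive_linear_error N y : is_derive y 1 (linear_error N) (const_error N y).
Proof.
have -> : linear_error N = (fun t => (pi ^+ 2 / 8 - pi / 2 * t) - 4 * cos_sum 2 N t).
  by apply/funext => t; rewrite /linear_error; congr (_ - _); field.
have d1 : is_derive y 1 (fun t : R => pi ^+ 2 / 8 - pi / 2 * t) (0 - pi / 2 * 1).
  exact: (is_deriveB (is_derive_cst (pi ^+ 2 / 8 : R) y (1 : R))
    (is_deriveZ (pi / 2 : R) (is_derive_id y (1 : R)))).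
apply: is_derive_eq (is_deriveB d1 (is_deriveZ 4 (is_derive_cos_sum 1 N y))) _.
by rewrite /GRing.scale /= /const_error; ring.
Qed.

Lemma linear_error_mid N : linear_error N (pi / 4) = 0.
Proof.
rewrite /linear_error /cos_sum big1 => [|i _]; first by field.
have -> : frq i * (pi / 4) = i.*2.+1%:R * (pi / 2) by rewrite /frq; field.
by rewrite cos_odd_pihalf mulr0.
Qed.

Lemma linear_error_sym N y : linear_error N (pi / 2 - y) = - linear_error N y.
Proof.
rewrite /linear_error; have -> : cos_sum 2 N (pi / 2 - y) = - cos_sum 2 N y.
  rewrite /cos_sum -sumrN; apply: eq_bigr => i _.
  have -> : frq i * (pi / 2 - y) = - (frq i * y) + pi *+ i.*2.+1.
    by rewrite /frq -[pi *+ _]mulr_natr; field.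
  rewrite (alternatingn (@cosDpi R)) cosN -signr_odd /= odd_double.
  by rewrite expr1 mulN1r mulrN.
by field.
Qed.

(* Leibniz' series for [pi / 4]. *)
Lemma const_error_mid (e : R) : 0 < e -> exists N0, forall N, (N0 <= N)%N ->
  `|const_error N (pi / 4)| <= e.
Proof.
move=> e0; have [N0 hN] := @strong_limit_ones R 0 e e0; exists N0 => N NN.
have := hN N 1 NN; rewrite mulr1 ler01 lexx => /(_ isT); rewrite (_ : (1`!)%N = 1%N) // divr1 expr1 theta1.
suff -> : tpoly (fun=> 1%N) 1 N 1 = 4 * sin_sum 1 N (pi / 4) by [].
rewrite /tpoly expr1 /sin_sum !mulr_sumr; apply: eq_bigr => i _.
have -> : frq i * (pi / 4) = i.*2.+1%:R * (pi / 2) by rewrite /frq; field.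
rewrite sin_odd_pihalf expr1n mulr1 /= big_ord_recl big1 => [|j _]; last by [].
rewrite /frq !expr1 addr0 mulr1 add1n.
have : i.*2.+1%:R != 0 :> R by rewrite pnatr_eq0.
by move: (_.+1%:R) => n n0; field.
Qed.

(** One integration by parts: the derivative [2 sin (4 N t) / sin (2 t)] of [const_error N]
    oscillates, and adding [corr] leaves a derivative dominated by that of [g], which is [O(1 / N)]
    away from 0. *)
Lemma const_error_bound N y : (0 < N)%N -> 0 < y <= pi / 4 ->
  `|const_error N y| <= `|const_error N (pi / 4)| + (N%:R * sin (2 * y))^-1.
Proof.
move=> N0 /andP[y0 y4]; have pi0 := pi_gt0 R.
have Nr : 0 < N%:R :> R by rewrite ltr0n.
have s_gt0 t : y <= t <= pi / 4 -> 0 < sin (2 * t).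
  by move=> /andP[yt t4]; apply: sin_gt0_pi; lra.
pose corr t : R := cos ((4 * N)%:R * t) * ((2 * N%:R) * sin (2 * t))^-1.
pose dcorr t : R := - (2 * sin ((4 * N)%:R * t) / sin (2 * t)
   + cos ((4 * N)%:R * t) * cos (2 * t) / (N%:R * sin (2 * t) ^+ 2)).
pose g t : R := - (2 * N%:R * sin (2 * t))^-1.
pose dg t : R := cos (2 * t) / (N%:R * sin (2 * t) ^+ 2).
have dinv t : y <= t <= pi / 4 -> is_derive t 1 (fun t => (2 * N%:R * sin (2 * t))^-1) (- dg t).
  move=> /s_gt0 st; pose f u : R := 2 * N%:R * sin (2 * u).
  have nz : f t != 0 by rewrite /f !mulf_neq0 ?gt_eqF.
  have ds : is_derive t 1 f (2 * N%:R * (2 * cos (2 * t))).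
    by apply: is_deriveZ; exact: is_derive_sinZ.
  apply: is_derive_eq (is_deriveV nz ds) _.
  rewrite /GRing.scale /= /dg /f; move: (sin _) (N%:R) (cos _) st Nr => s n c s0 n0.
  by field; rewrite !gt_eqF.
have cont (h : R -> R) (dh : R -> R) : (forall t, y <= t <= pi / 4 -> is_derive t 1 h (dh t)) ->
    primitive_on y (pi / 4) h dh.
  move=> hd; split=> [|t /andP[t1 t2]]; last by apply: hd; lra.
  apply: derivable_within_continuous => t; rewrite in_itv /= => ht.
  by have := hd t ht => ?; exact: ex_derive.
have pg : primitive_on y (pi / 4) g dg.
  apply: cont => t ht; rewrite -[dg t]opprK; apply: is_deriveN; exact: dinv.
have pf : primitive_on y (pi / 4) (fun t => const_error N t + corr t)
    (fun t => 4 * cos_sum 0 N t + dcorr t).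
  apply: primitive_onD; apply: cont => t ht.
    apply: is_derive_eq (is_deriveB (is_deriveZ 4 (is_derive_sin_sum 0 N t))
      (is_derive_cst (pi / 2 : R) t (1 : R))) _.
    by rewrite subr0.
  apply: is_derive_eq (is_deriveM (is_derive_cosZ _ t) (dinv t ht)) _.
  rewrite /GRing.scale /= /dg /dcorr natrM.
  have := s_gt0 t ht; move: (sin (2 * t)) (cos (_ * t)) (sin (_ * t)) (N%:R) Nr => s c d n n0 s0.
  by field; rewrite !gt_eqF.
have := primitive_on_le y4 pf pg; rewrite /corr /g => /(_ _) h.
have {h} : `|const_error N (pi / 4) + corr (pi / 4) - (const_error N y + corr y)| <=
    (2 * N%:R * sin (2 * y))^-1 - (2 * N%:R)^-1.
  have e4 : sin (2 * (pi / 4)) = 1 :> R.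
    by rewrite (_ : 2 * (pi / 4) = pi / 2) ?sin_pihalf //; field.
  rewrite [leRHS](_ : _ = - (2 * N%:R * sin (2 * (pi / 4)))^-1
    - - (2 * N%:R * sin (2 * y))^-1); last by rewrite e4 mulr1; ring.
  apply: h => t /andP[t1 t2]; have ht : y <= t <= pi / 4 by lra.
  have st := s_gt0 t ht.
  have -> : 4 * cos_sum 0 N t + dcorr t =
      - (cos ((4 * N)%:R * t)) * dg t.
    have := sum_cos_frq N t; rewrite /dcorr /dg => e.
    have -> : cos_sum 0 N t = sin ((4 * N)%:R * t) / 2 / sin (2 * t).
      by rewrite -e mulrC mulKf // gt_eqF.
    move: (sin (2 * t)) (cos (_ * t)) (cos (_ * t)) (sin (_ * t)) (N%:R) Nr st => s c c' d n n0 s0.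
    by field; rewrite !gt_eqF.
  have dg0 : 0 <= dg t.
    rewrite /dg divr_ge0 ?mulr_ge0 ?exprn_ge0 ?(ltW st) ?(ltW Nr) //.
    by apply: cos_ge0_pihalf; lra.
  by rewrite normrM normrN (ger0_norm dg0) ler_piMl // cos_max.
set s := sin (2 * y); have s0 : 0 < s by apply: s_gt0; lra.
have corr_le t (u : R) : sin (2 * t) = u -> 0 < u -> `|corr t| <= (2 * N%:R * u)^-1.
  move=> <- u0; rewrite /corr normrM [`|_^-1|]gtr0_norm ?invr_gt0 ?mulr_gt0 //.
  by rewrite ler_piMl ?invr_ge0 ?mulr_ge0 ?(ltW u0) ?(ltW Nr) // cos_max.
have c1 : `|corr (pi / 4)| <= (2 * N%:R)^-1.
  have := corr_le (pi / 4) 1; rewrite mulr1; apply => //.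
  by rewrite (_ : 2 * (pi / 4) = pi / 2) ?sin_pihalf //; field.
have c2 := corr_le y s erefl s0.
(* The bound on [corr] at [pi / 4] cancels the subtracted [(2 * N%:R)^-1], which leaves twice the
   bound at [y]. *)
have -> : (N%:R * s)^-1 = (2 * N%:R * s)^-1 + (2 * N%:R * s)^-1.
  by field; rewrite (gt_eqF Nr) (gt_eqF s0).
move: c1 c2; move: (corr _) (corr _) (const_error N _) (const_error N _) => a b c d.
move: (_^-1) (_^-1) => u v; rewrite !ler_norml => /andP[? ?] /andP[? ?] /andP[? ?].
have := ler_norm d; have := ler_norm (- d); rewrite normrN => ? ?.
by apply/andP; split; lra.
Qed.

(** [linear_error] vanishes at [pi / 4], and its derivative is small from there down to [y] because
    [sin (2 t)] is at least [sin (2 y)] on that range. The rank obtained depends on [y]; uniformity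
    comes from [linear_error_tail]. *)
Lemma linear_error_cvg y (e : R) : 0 < y < pi / 2 -> 0 < e ->
  exists N0, forall N, (N0 <= N)%N -> `|linear_error N y| <= e.
Proof.
wlog y4 : y / y <= pi / 4 => [th|].
  have [y4|y4] := leP y (pi / 4); first exact: th.
  move=> /andP[y0 y2] e0; have [||N0 hN] := th (pi / 2 - y) _ _ e0; [lra|lra|].
  by exists N0 => N /hN; rewrite linear_error_sym normrN.
move=> /andP[y0 _] e0; set s := sin (2 * y).
have pi0 := pi_gt0 R; have pi4 := pi_le4.
have s0 : 0 < s by apply: sin_gt0_pi; lra.
have [N1 hN1] := const_error_mid (e := e / 2) ltac:(lra).
have es0 : 0 < 2 / (e * s) by rewrite divr_gt0 ?mulr_gt0.
exists (maxn N1 (Num.bound (2 / (e * s)))) => N; rewrite geq_max => /andP[NN1 NN2].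
have Nb : 2 / (e * s) <= N%:R.
  apply: ltW; apply: lt_le_trans (archi_boundP (ltW es0)) _; by rewrite ler_nat.
have Nr : 0 < N%:R :> R by apply: lt_le_trans es0 Nb.
have N0 : (0 < N)%N by rewrite -(ltr0n R).
have Ns : (N%:R * s)^-1 <= e / 2.
  have -> : e / 2 = (2 / (e * s) * s)^-1 by field; rewrite !gt_eqF.
  by rewrite lef_pV2 ?posrE; [exact: ler_wpM2r (ltW s0) _ _ Nb|exact: mulr_gt0|exact: mulr_gt0].
have := primitive_on_bound y4 (derive_primitive_on y (pi / 4) (is_derive_linear_error N)) (K := e).
rewrite linear_error_mid sub0r normrN => /(_ _)/le_trans; apply; last first.
  by rewrite ler_piMr ?(ltW e0) //; lra.
move=> t /andP[t1 t2]; have t0 : 0 < t <= pi / 4 by lra.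
apply: le_trans (const_error_bound N0 t0) _; rewrite [leRHS]splitr lerD ?hN1 //.
apply: le_trans Ns; rewrite lef_pV2 ?posrE ?mulr_gt0 //; last by apply: sin_gt0_pi; lra.
rewrite ler_pM2l //.
have ps : primitive_on y t (fun t => sin (2 * t)) (fun t => 2 * cos (2 * t)).
  by apply: derive_primitive_on => u; exact: is_derive_sinZ.
have p0 : primitive_on y t (cst 0) (fun=> 0 : R).
  by apply: derive_primitive_on => u; exact: is_derive_cst.
have := primitive_on_le (ltW t1) p0 ps; rewrite subrr normr0 subr_ge0; apply.
by move=> u /andP[u1 u2]; rewrite mulr_ge0 // cos_ge0_pihalf //; lra.
Qed.

(** Whatever [y] is, the term of index [M] is at most [1 / (2 M + 1)^2], which is below the
    telescoping difference [1 / (M (M + 1))]. *)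
Lemma linear_error_tail N M y : (0 < N)%N -> (N <= M)%N ->
  `|linear_error N y - linear_error M y| <= N%:R^-1 - M%:R^-1.
Proof.
move=> N0; elim: M => [|M IHM]; first by rewrite leqn0 => /eqP e; rewrite e in N0.
rewrite leq_eqVlt => /predU1P[->|NM]; first by rewrite !subrr normr0.
have {}NM : (N <= M)%N by rewrite -ltnS.
have M0 : (0 < M)%N by exact: leq_trans NM.
have {}IHM := IHM NM.
have step : `|linear_error M y - linear_error M.+1 y| <= M%:R^-1 - M.+1%:R^-1.
  have -> : linear_error M y - linear_error M.+1 y = 4 * ((frq M ^+ 2)^-1 * cos (frq M * y)).
    by rewrite /linear_error /cos_sum big_ord_recr /=; ring.
  have f2 : 0 < (frq M ^+ 2)^-1 by rewrite invr_gt0 exprn_gt0 // frq_gt0.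
  rewrite !normrM (ger0_norm (ltW f2)) (@ger0_norm _ 4) //.
  apply: (@le_trans _ _ (4 * (frq M ^+ 2)^-1)).
    by rewrite ler_pM2l // ler_piMr ?(ltW f2) // cos_max.
  have Mr : 1 <= M%:R :> R by rewrite ler1n.
  have fE : frq M = 2 * (M%:R * 2 + 1) by rewrite /frq -muln2 -[(M * 2).+1%:R]natr1 natrM.
  rewrite fE -[M.+1%:R]natr1; move: (M%:R) Mr => m m1.
  have m0 : 0 < m by lra.
  have -> : m^-1 - (m + 1)^-1 = (m * (m + 1))^-1 by field; rewrite !gt_eqF //; lra.
  have -> : 4 * ((2 * (m * 2 + 1)) ^+ 2)^-1 = ((m * 2 + 1) ^+ 2)^-1.
    by field; rewrite gt_eqF //; lra.
  rewrite lef_pV2 ?posrE ?exprn_gt0 ?mulr_gt0 //; [nra|lra|lra].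
apply: le_trans (ler_distD (linear_error M y) _ _) _.
by rewrite [leRHS](_ : _ = (N%:R^-1 - M%:R^-1) + (M%:R^-1 - M.+1%:R^-1)) ?lerD //; ring.
Qed.

Lemma linear_error_bound N y : (0 < N)%N -> 0 < y < pi / 2 ->
  `|linear_error N y| <= N%:R^-1.
Proof.
move=> N0 y01; apply/ler_addgt0Pr => e e0.
have [M hM] := linear_error_cvg y01 e0.
have := hM (maxn N M) (leq_maxr _ _); have := linear_error_tail y N0 (leq_maxl N M).
move=> h1 h2; rewrite -[linear_error N y](subrK (linear_error (maxn N M) y)).
apply: le_trans (ler_normD _ _) _; apply: lerD => //; apply: le_trans h1 _.
by rewrite lerBlDr lerDl invr_ge0.
Qed.

End SineSeries.

(** * Entringer and Dumont forms *)

Section HomogeneousPolynomials.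
Variable R : realType.
Implicit Types (g : nat -> R) (x y : R).

(* The binary form [sum_m g_m u^m v^(n - m) / (m! (n - m)!)] at [u + v = pi / 2];
   differentiation acts on the coefficients as a finite difference. *)
Definition bform n g y : R := \sum_(m < n.+1)
  g m * (y ^+ m / m`!%:R * ((pi / 2 - y) ^+ (n - m) / (n - m)`!%:R)).

Lemma eq_bform n g g' y : (forall m, (m <= n)%N -> g m = g' m) ->
  bform n g y = bform n g' y.
Proof. by move=> e; apply: eq_bigr => m _; rewrite e // leq_ord. Qed.

Lemma bformN n g y : bform n (fun m => - g m) y = - bform n g y.
Proof. by rewrite /bform -sumrN; apply: eq_bigr => m _; rewrite mulNr. Qed.

Lemma is_derive_divided_power n y :
  is_derive y 1 (fun t : R => t ^+ n.+1 / n.+1`!%:R) (y ^+ n / n`!%:R).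
Proof.
have -> : (fun t : R => t ^+ n.+1 / n.+1`!%:R) = (fun t => n.+1`!%:R^-1 * t ^+ n.+1).
  by apply/funext => t; rewrite mulrC.
apply: is_derive_eq (is_deriveZ _ (is_derive_exprn _ y)) _.
rewrite /GRing.scale /= factS natrM.
have : n.+1%:R != 0 :> R by rewrite pnatr_eq0.
have : n`!%:R != 0 :> R by rewrite pnatr_eq0 -lt0n fact_gt0.
by move: (n.+1%:R) (n`!%:R) => p q p0 q0; field; rewrite p0 q0.
Qed.

Lemma is_derive_bform n g y :
  is_derive y 1 (bform n.+1 g) (bform n (fun m => g m.+1 - g m) y).
Proof.
pose u m t : R := t ^+ m / m`!%:R.
pose v m t : R := u m (pi / 2 - t).
have dv m (t : R) : is_derive t 1 (v m.+1) (- v m t).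
  have dsub : is_derive t 1 (fun t : R => pi / 2 - t) (0 - 1).
    exact: is_deriveB (is_derive_cst (pi / 2 : R) t (1 : R)) (is_derive_id t (1 : R)).
  have du : is_derive (pi / 2 - t) 1 (u m.+1) (u m (pi / 2 - t)).
    exact: is_derive_divided_power.
  have -> : - v m t = u m (pi / 2 - t) * (0 - 1) by rewrite sub0r mulrN1.
  exact: (@is_derive1_comp R (u m.+1) (fun s => pi / 2 - s) t _ _ du dsub).
have c0 (w : nat -> R -> R) : w 0%N = u 0%N \/ w 0%N = v 0%N -> w 0%N = cst 1.
  by case=> ->; apply/funext => t; rewrite /v /u fact0 divr1.
pose h m (t : R) : R := g m * (u m t * v (n.+1 - m)%N t).
pose dh m (t : R) : R := g m * ((if m is m'.+1 then u m' t else 0) * v (n.+1 - m)%N t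
   - (if (m <= n)%N then u m t * v (n - m)%N t else 0)).
have hd m : (m < n.+2)%N -> is_derive y 1 (h m) (dh m y).
  move=> mn; apply: is_deriveZ.
  have du : is_derive y 1 (u m) (if m is m'.+1 then u m' y else 0).
    case: m {mn} => [|m]; last exact: is_derive_divided_power.
    by rewrite (c0 u) ; [exact: is_derive_cst|left].
  have dv' : is_derive y 1 (v (n.+1 - m)%N) (- (if (m <= n)%N then v (n - m)%N y else 0)).
    case: leqP => [mn'|nm]; first by rewrite subSn.
    have -> : (n.+1 - m = 0)%N by lia.
    by rewrite (c0 v) ?oppr0; [exact: is_derive_cst|right].
  apply: is_derive_eq (is_deriveM du dv') _.
  rewrite /GRing.scale /= [X in _ + X]mulrC addrC; congr (_ + _).
  by case: ifP => _; rewrite ?oppr0 ?mulr0 // mulrN.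
apply: is_derive_eq (is_derive_sum_fun hd) _.
under eq_bigr do rewrite /dh mulrBr.
rewrite big_split sumrN /= big_ord_recl [X in _ - X]big_ord_recr /=.
rewrite mul0r mulr0 add0r ltnn mulr0 addr0 /bform -sumrN -big_split.
apply: eq_bigr => m _ /=; rewrite /bump /= add1n subSS leq_ord /v /u.
by rewrite mulrBl.
Qed.

Lemma bform_pihalf n g : bform n g (pi / 2) = g n * ((pi / 2) ^+ n / n`!%:R).
Proof.
rewrite /bform big_ord_recr big1 /= ?add0r => [|m _].
  by rewrite subnn expr0 fact0 divr1 mulr1.
by rewrite subrr expr0n subn_eq0 leqNgt ltn_ord !mul0r !mulr0.
Qed.

Lemma bform_0 n g : bform n g 0 = g 0%N * ((pi / 2) ^+ n / n`!%:R).
Proof.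
rewrite /bform big_ord_recl big1 /= ?addr0 => [|m _].
  by rewrite expr0 fact0 divr1 mul1r subn0 subr0.
by rewrite expr0n !mul0r mulr0.
Qed.

(** The reversed index [k - m] puts the Entringer index on the power of [pi / 2 - y], as the theorem
    requires; the finite difference of the coefficients is then the boustrophedon recurrence. *)
Definition zigzag_form k b := bform k (fun m => (zigzag k b (k - m))%:R).

Lemma is_derive_zigzag_down k y :
  is_derive y 1 (zigzag_form k.+1 false) (- zigzag_form k true y).
Proof.
apply: is_derive_eq (is_derive_bform _ _ y) _; rewrite -bformN; apply: eq_bform => m mk.
by rewrite subSS subSn // zigzag_downS ?leq_subr // natrD opprD addNKr.
Qed.

Lemma is_derive_zigzag_up k y :
  is_derive y 1 (zigzag_form k.+1 true) (zigzag_form k false y).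
Proof.
apply: is_derive_eq (is_derive_bform _ _ y) _; apply: eq_bform => m mk.
by rewrite subSS subSn // [zigzag _ _ (k - m)]zigzag_upS ?leq_subr // natrD addrC addKr.
Qed.

Lemma zigzag_form0 b y : zigzag_form 0 b y = 1.
Proof. by rewrite /zigzag_form /bform big_ord1 !expr0 fact0 divr1 !mulr1. Qed.

Lemma zigzag_down_pihalf k : zigzag_form k.+1 false (pi / 2) = 0.
Proof. by rewrite /zigzag_form bform_pihalf subnn zigzag_down0 mul0r. Qed.

Lemma zigzag_up_0 k : zigzag_form k.+1 true 0 = 0.
Proof. by rewrite /zigzag_form bform_0 subn0 zigzag_up_max mul0r. Qed.

(* The cosine coefficients of the Entringer polynomial, by double integration by
   parts. *)
Lemma zigzag_cos_primitive k j : odd k -> exists A : R -> R,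
  (forall y, is_derive y 1 A (zigzag_form k false y * cos (j.*2.+1%:R * y))) /\
  A (pi / 2) - A 0 = (j.*2.+1%:R ^+ k.+1)^-1.
Proof.
set c : R := j.*2.+1%:R; have c0 : c != 0 by rewrite pnatr_eq0.
have step k' (B : R -> R) (b : R -> R) :
    (forall y, is_derive y 1 (zigzag_form k' true) (b y)) ->
    (forall y, is_derive y 1 B (b y * cos (c * y))) ->
    forall y, is_derive y 1 (fun t => zigzag_form k'.+1 false t * sin (c * t) / c
        - zigzag_form k' true t * cos (c * t) / c ^+ 2 + B t / c ^+ 2)
      (zigzag_form k'.+1 false y * cos (c * y)).
  move=> db dB y.
  have e (f : R -> R) d : (fun t => f t / d) = (fun t => d^-1 * f t).
    by apply/funext => t; rewrite mulrC.
  have d1 := is_deriveZ c^-1 (is_deriveM (is_derive_zigzag_down k' y) (is_derive_sinZ c y)).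
  have d2 := is_deriveZ (c ^+ 2)^-1 (is_deriveM (db y) (is_derive_cosZ c y)).
  have d3 := is_deriveZ (c ^+ 2)^-1 (dB y).
  rewrite (_ : (fun t => _) = (fun t => c^-1 * (zigzag_form k'.+1 false t * sin (c * t))
     - (c ^+ 2)^-1 * (zigzag_form k' true t * cos (c * t)) + (c ^+ 2)^-1 * B t)); last first.
    by apply/funext => t; field.
  apply: is_derive_eq (is_deriveD (is_deriveB d1 d2) d3) _.
  by rewrite /GRing.scale /=; field.
have cY : cos (c * (pi / 2)) = 0 by exact: cos_odd_pihalf.
move=> ok; have -> : k = k./2.*2.+1 by rewrite -[LHS]odd_double_half ok.
elim: (k./2) => [|t [B [dB BE]]].
  exists (fun t => zigzag_form 1 false t * sin (c * t) / c
        - zigzag_form 0 true t * cos (c * t) / c ^+ 2 + 0 / c ^+ 2); split.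
    apply: (step 0%N (cst 0) (cst 0)) => y.
      rewrite (_ : zigzag_form 0 true = cst 1); first exact: is_derive_cst.
      by apply/funext => t; rewrite zigzag_form0.
    by rewrite /= mul0r; exact: is_derive_cst.
  rewrite zigzag_down_pihalf cY !zigzag_form0 !mulr0 sin0 cos0.
  by field.
exists (fun s => zigzag_form t.*2.+3 false s * sin (c * s) / c
        - zigzag_form t.*2.+2 true s * cos (c * s) / c ^+ 2 + B s / c ^+ 2); split.
  by apply: step dB => y; exact: is_derive_zigzag_up.
rewrite zigzag_down_pihalf cY zigzag_up_0 !mulr0 sin0 !mul0r mulr0 !mul0r subrr !add0r.
rewrite -mulrBl BE doubleS -(addn2 t.*2.+2) exprD.
by symmetry; exact: invfM.
Qed.

Definition dumont_form n := bform n.+2 (fun m => (dumont_count n m)%:R).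
Definition dumont_form' n := bform n.+1
  (fun m => (dumont_count n m.+1)%:R - (dumont_count n m)%:R).

Lemma is_derive_dumont_form n y : is_derive y 1 (dumont_form n) (dumont_form' n y).
Proof. exact: is_derive_bform. Qed.

Lemma is_derive_dumont_form' n y : odd n ->
  is_derive y 1 (dumont_form' n.+2) (- dumont_form n y).
Proof.
move=> on; apply: is_derive_eq (is_derive_bform _ _ y) _.
rewrite -bformN; apply: eq_bform => m mn.
have /(congr1 (fun k => k%:R : R)) := dumont_count_recurrence on mn.
by rewrite -addnn !natrD => e; lra.
Qed.

Lemma dumont_form_0 n : dumont_form n 0 = 0.
Proof. by rewrite /dumont_form bform_0 mul0r. Qed.

Lemma dumont_form_pihalf n : dumont_form n (pi / 2) = 0.
Proof. by rewrite /dumont_form bform_pihalf /dumont_count ltnn mul0r. Qed.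

(** The base case of [dumont_series]: exactly the linear function whose cosine series [linear_error]
    controls. *)
Lemma dumont_form'_1 y : dumont_form' 1 y = pi / 2 * (pi / 2 - 2 * y) / 2.
Proof.
have w0 : dumont_words 1 0 = 1%N.
  by rewrite /dumont_words labelled_words_up // (sum_ord_geD1 _ (leq0n _)) big_pred0 // => -[[]].
have w1 : dumont_words 1 1 = 1%N by have := @dumont_words_rev 1 0 isT isT; rewrite subn0 w0.
rewrite /dumont_form' /bform !big_ord_recl big_ord0 /dumont_count /= w0 w1 /bump /=.
rewrite (_ : (2`!)%N = 2%N) // (_ : (1`!)%N = 1%N) //.
rewrite subn0 !addn0 (_ : (2 - (1 + 1) = 0)%N) // (_ : (2 - 1 = 1)%N) // fact0 addn1.
by field.
Qed.

(* The error of the [N]-th partial sum of the sine series of a Dumont form. *)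
Lemma dumont_series n : odd n -> forall e : R, 0 < e -> exists N0,
  forall N y, (N0 <= N)%N -> 0 < y < pi / 2 ->
  `|dumont_form' n y - 4 * cos_sum n.+1 N y| <= e.
Proof.
have pi0 := pi_gt0 R; have pi4 := pi_le4 R.
have dE p N y : is_derive y 1 (fun t => dumont_form p t - 4 * sin_sum p.+2 N t)
    (dumont_form' p y - 4 * cos_sum p.+1 N y).
  exact: is_deriveB (is_derive_dumont_form p y) (is_deriveZ 4 (is_derive_sin_sum p.+1 N y)).
move=> on; have -> : n = n./2.*2.+1 by rewrite -[LHS]odd_double_half on.
elim: (n./2) => [|t IHt] e e0.
  exists (Num.bound e^-1).+1 => N y NN y01; rewrite dumont_form'_1.
  have eN : e^-1 <= N%:R.
    apply: ltW; apply: lt_le_trans (archi_boundP _) _; first by rewrite invr_ge0 ltW.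
    by rewrite ler_nat ltnW.
  apply: le_trans (linear_error_bound _ y01) _; first exact: leq_trans NN.
  by rewrite -[e]invrK lef_pV2 ?posrE ?invr_gt0 // (lt_le_trans _ eN) ?invr_gt0.
set n' := t.*2.+1 in IHt *; have on' : odd n' by rewrite /= odd_double.
rewrite (_ : t.+1.*2.+1 = n'.+2) //.
(* Two integrations over lengths at most [pi / 2 <= 2] follow, each at most doubling the bound:
   [e / 4], [e / 2], [e]. *)
have [N0 hN] := IHt (e / 4) ltac:(lra); exists N0 => N y NN /andP[y0 y2].
have E_le z : 0 <= z <= pi / 2 ->
    `|dumont_form n' z - 4 * sin_sum n'.+2 N z| <= e / 2.
  move=> /andP[z0 z2].
  have := primitive_on_bound z0 (derive_primitive_on 0 z (dE n' N)) (K := e / 4).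
  rewrite dumont_form_0 sin_sum0 mulr0 !subr0 => /(_ _)/le_trans; apply.
    by move=> s /andP[s0 sz]; apply: hN => //; lra.
  by rewrite (_ : e / 2 = e / 4 * 2) ?ler_pM2l; [lra|lra|field].
pose f s : R := dumont_form n'.+2 s - 4 * sin_sum n'.+4 N s.
pose df s : R := dumont_form' n'.+2 s - 4 * cos_sum n'.+3 N s.
have ddf (s : R) : is_derive s 1 df (- (dumont_form n' s - 4 * sin_sum n'.+2 N s)).
  apply: is_derive_eq (is_deriveB (is_derive_dumont_form' s on')
    (is_deriveZ 4 (is_derive_cos_sum n'.+2 N s))) _.
  by rewrite /GRing.scale /=; ring.
have Y0 : 0 < pi / 2 :> R by lra.
have [pf1 pf2] := derive_primitive_on 0 (pi / 2) (dE n'.+2 N).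
have fd (z : R) : z \in `]0, pi / 2[ -> is_derive z 1 f (df z) by rewrite in_itv; exact: pf2.
(* Rolle: [f] vanishes at both ends, so [df] has a zero [z] inside, from which [df] is integrated.
   The cosine series need not be evaluated at an end point, and the dependence of [z] on [N] is
   harmless. *)
have [z zY] := MVT Y0 fd pf1; rewrite in_itv /= in zY.
rewrite /f dumont_form_0 sin_sum0 dumont_form_pihalf sin_sum_pihalf subrr => /esym/eqP.
rewrite subr0 mulf_eq0 (gt_eqF Y0) orbF => /eqP dfz.
have key (a b : R) : 0 < a -> a <= b -> b < pi / 2 -> `|df b - df a| <= e.
  move=> a0 ab b2; apply: (@le_trans _ _ (e / 2 * (b - a))).
    apply: primitive_on_bound ab (derive_primitive_on a b ddf) _ => s /andP[s1 s2].
    by rewrite normrN E_le //; lra.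
  by rewrite [leRHS](_ : _ = e / 2 * 2) ?ler_pM2l; [lra|lra|field].
rewrite -/(df y); case/andP: zY => z0 z2; have [yz|zy] := leP y z.
  by have := key y z y0 yz z2; rewrite dfz sub0r normrN.
by have := key z y z0 (ltW zy) y2; rewrite dfz subr0.
Qed.

End HomogeneousPolynomials.

(** * Assembling both sides of the formula *)

Section SumFormula.
Variable R : realType.

Lemma sum_from1 n (F : nat -> R) : \sum_(1 <= i < n.+1) F i = \sum_(i < n) F i.+1.
Proof. by rewrite big_add1 /= big_mkord. Qed.

Lemma bin_divided_power p m (x : R) :
  'C(p + m, m)%:R * (x ^+ (p + m) / (p + m)`!%:R) = x ^+ p / p`!%:R * (x ^+ m / m`!%:R).
Proof.
have nz q : q`!%:R != 0 :> R by rewrite pnatr_eq0 -lt0n fact_gt0.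
have /(congr1 (fun k => k%:R : R)) := bin_fact (leq_addl p m).
rewrite addnK !natrM exprD => e; rewrite -e.
have : 'C(p + m, m)%:R != 0 :> R by rewrite pnatr_eq0 -lt0n bin_gt0 leq_addl.
have := nz p; have := nz m.
move: (_%:R) (_%:R) (_%:R) (x ^+ p) (x ^+ m) => b c d u v b0 c0 d0.
by field; rewrite b0 c0 d0.
Qed.

Lemma zigzag_formE k y : (0 < k)%N -> zigzag_form (R := R) k false y =
  \sum_(i < k) (entringer k i.+1)%:R *
    (y ^+ (k - i.+1) / (k - i.+1)`!%:R * ((pi / 2 - y) ^+ i.+1 / i.+1`!%:R)).
Proof.
case: k => // k _; rewrite /zigzag_form /bform (reindex_inj rev_ord_inj) /=.
under eq_bigr => i _ do rewrite subSS subKn ?leq_ord //.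
rewrite big_ord_recl /= zigzag_down0 mul0r add0r.
by apply: eq_bigr => i _; rewrite /bump /= add1n subSS entringerE // ltnW // ltnS.
Qed.

Lemma dumont_formE n y : dumont_form (R := R) n y =
  \sum_(j < n.+2) (dumont n.+2 j.+1)%:R *
    (y ^+ j.+1 / j.+1`!%:R * ((pi / 2 - y) ^+ (n.+2 - j.+1) / (n.+2 - j.+1)`!%:R)).
Proof.
rewrite /dumont_form /bform big_ord_recl mul0r add0r.
by apply: eq_bigr => j _; rewrite dumontE.
Qed.

Lemma Ttilde_sum_primitive k1 n : (0 < k1)%N -> exists Z : R -> R,
  [/\ Z 0 = 0, primitive_on 0 1 Z
        (fun x => zigzag_form k1 false (theta x) * dumont_form n (theta x) / x) &
   \sum_(1 <= l < k1.+1) \sum_(1 <= m < n.+3)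
    ('C(k1 - l + m, m) * 'C(n.+2 - m + l, l)
       * entringer k1 l * dumont n.+2 m)%N%:R
    * Ttilde R (index_2_1s (k1 - l + m - 1) (n.+2 - m + l)) = Z 1].
Proof.
move=> k1_gt0.
have /choice[S HS] : forall p : nat * nat, exists S : R -> R,
  [/\ S 0 = 0, primitive_on 0 1 S (fun x => theta x ^+ p.1.+1 / p.1.+1`!%:R
        * ((pi / 2 - theta x) ^+ p.2 / p.2`!%:R) / x) &
      Ttilde R (index_2_1s p.1 p.2) = S 1].
  by move=> [a b]; exact: Ttilde_primitive.
pose coef l m : R := ('C(k1 - l + m, m) * 'C(n.+2 - m + l, l)
       * entringer k1 l * dumont n.+2 m)%N%:R.
pose s l m := S ((k1 - l + m - 1)%N, (n.+2 - m + l)%N).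
exists (fun x => \sum_(i < k1) \sum_(j < n.+2) coef i.+1 j.+1 * s i.+1 j.+1 x); split.
- rewrite big1 // => i _; rewrite big1 // => j _.
  by have [S0 _ _] := HS ((k1 - i.+1 + j.+1 - 1)%N, (n.+2 - j.+1 + i.+1)%N); rewrite /s S0 mulr0.
- pose ds l m x : R := theta x ^+ (k1 - l + m - 1).+1 / (k1 - l + m - 1).+1`!%:R
        * ((pi / 2 - theta x) ^+ (n.+2 - m + l) / (n.+2 - m + l)`!%:R) / x.
  have ps l m : primitive_on 0 1 (s l m) (ds l m).
    by have [_ ? _] := HS ((k1 - l + m - 1)%N, (n.+2 - m + l)%N).
  pose h i x := \sum_(j < n.+2) coef i.+1 j.+1 * s i.+1 j.+1 x.
  pose dh i x := \sum_(j < n.+2) coef i.+1 j.+1 * ds i.+1 j.+1 x.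
  have ph i : (i < k1)%N -> primitive_on 0 1 (h i) (dh i).
    move=> _; pose g j x := coef i.+1 j.+1 * s i.+1 j.+1 x.
    pose dg j x := coef i.+1 j.+1 * ds i.+1 j.+1 x.
    by apply: (@primitive_on_sum R 0 1 n.+2 g dg) => j _; exact: primitive_onZ.
  apply: eq_primitive_on (primitive_on_sum ph) _ => x _.
  rewrite zigzag_formE // dumont_formE mulr_suml mulr_suml; apply: eq_bigr => i _.
  rewrite mulr_sumr mulr_suml; apply: eq_bigr => j _.
  rewrite /ds /coef mulrA; congr (_ / x).
  have -> : ((k1 - i.+1 + j.+1 - 1).+1 = k1 - i.+1 + j.+1)%N by lia.
  have := bin_divided_power (k1 - i.+1) j.+1 (theta x).
  have := bin_divided_power (n.+2 - j.+1) i.+1 (pi / 2 - theta x).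
  rewrite !natrM.
  move: (_ / _) => v; move: (_ / _) => v1; move: (_ / _) => v2 => e1.
  move: (_ / _) => u; move: (_ / _) => u1; move: (_ / _) => u2 => e2.
  transitivity ('C(k1 - i.+1 + j.+1, j.+1)%:R * u * ('C(n.+2 - j.+1 + i.+1, i.+1)%:R * v)
     * ((entringer k1 i.+1)%:R * (dumont n.+2 j.+1)%:R)); first by ring.
  by rewrite e1 e2; ring.
- rewrite sum_from1; apply: eq_bigr => i _; rewrite sum_from1; apply: eq_bigr => j _.
  by have [_ _ /= e] := HS ((k1 - i.+1 + j.+1 - 1)%N, (n.+2 - j.+1 + i.+1)%N); rewrite e.
Qed.

(** With [n = i.*2.+1], [frq R i] is [2 n] and the [n] numbers [j.*2.+1] are the odd ones below it.
    The factor 8 is the 4 of the sine series times the 2 of [sum_cos_odd]. *)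
Definition double_sum k1 k2 N : R := \sum_(i < N) 8 * (frq R i ^+ k2)^-1 *
  \sum_(j < i.*2.+1) (j.*2.+1%:R ^+ k1.+1)^-1.

Lemma sin_theta (x : R) : sin (theta x) = x * dtheta x.
Proof.
have -> : theta x = atan x *+ 2 by rewrite /theta mulr_natl.
rewrite sin_mulr2n; have c0 : cos (atan x) != 0.
  by rewrite gt_eqF // cos_gt0_pihalf // atan_gtNpi2 atan_ltpi2.
have -> : sin (atan x) = x * cos (atan x).
  by have := atanK x; rewrite /tan => {2}<-; rewrite divfK.
have := cos2_tan2 c0; rewrite atanK /dtheta => <-.
rewrite invrK; ring.
Qed.

Lemma double_sum_primitive k1 k2 N : odd k1 -> exists Z : R -> R,
  [/\ Z 0 = 0, primitive_on 0 1 Z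
        (fun x => zigzag_form k1 false (theta x) * (4 * sin_sum k2 N (theta x)) / x) &
      Z 1 = double_sum k1 k2 N].
Proof.
move=> ok1; have /choice[A HA] := fun j => zigzag_cos_primitive R j ok1.
exists (fun x => \sum_(i < N) 8 * (frq R i ^+ k2)^-1 *
  \sum_(j < i.*2.+1) (A j (theta x) - A j 0)); split.
- rewrite big1 // => i _; rewrite big1 ?mulr0 // => j _; by rewrite theta0 subrr.
- pose g j x := A j (theta x) - A j 0.
  pose dg j x : R := zigzag_form k1 false (theta x) * cos (j.*2.+1%:R * theta x) * dtheta x.
  have dgP j (x : R) : is_derive x 1 (g j) (dg j x).
    rewrite -[dg j x]subr0; apply: is_deriveB.
    exact: (@is_derive1_comp R (A j) (@theta R) x _ _ ((HA j).1 _) (is_derive_theta x)).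
  pose h i (x : R) : R := 8 * (frq R i ^+ k2)^-1 * \sum_(j < i.*2.+1) g j x.
  pose dh i (x : R) : R := 8 * (frq R i ^+ k2)^-1 * \sum_(j < i.*2.+1) dg j x.
  have hP i (x : R) : is_derive x 1 (h i) (dh i x).
    by apply: is_deriveZ; apply: is_derive_sum_fun => j _; exact: dgP.
  apply: eq_primitive_on (derive_primitive_on 0 1
    (fun x => @is_derive_sum_fun R N h dh x (fun i _ => hP i x))) _ => x /andP[x0 _].
  rewrite /sin_sum mulr_sumr mulr_sumr mulr_suml; apply: eq_bigr => i _.
  rewrite /dh /dg -mulr_suml -mulr_sumr.
  have := sum_cos_odd i.*2.+1 (theta x); rewrite sin_theta natrM -/(frq R i) => <-.
  have xn : x != 0 by rewrite gt_eqF.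
  by move: (\sum_(_ < _) _) (zigzag_form _ _ _) (_^-1) => a b c; field.
- apply: eq_bigr => i _; congr (_ * _); apply: eq_bigr => j _.
  by rewrite theta1 (HA j).2.
Qed.

Lemma bform_bound n (g : nat -> R) : exists2 C, 0 < C &
  forall y, 0 <= y <= pi / 2 -> `|bform n g y| <= C.
Proof.
pose c m : R := (pi / 2) ^+ m / m`!%:R.
have c_ge0 m : 0 <= c m by rewrite divr_ge0 ?exprn_ge0 ?divr_ge0 ?pi_ge0.
have le_c m y : 0 <= y <= pi / 2 -> `|y ^+ m / m`!%:R| <= c m.
  move=> /andP[y0 y2]; rewrite ger0_norm ?divr_ge0 ?exprn_ge0 //.
  by rewrite ler_pM2r ?invr_gt0 ?ltr0n ?fact_gt0 // lerXn2r ?nnegrE ?(le_trans y0 y2).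
exists (\sum_(m < n.+1) `|g m| * (c m * c (n - m)%N) + 1) => [|y y01].
  apply: ltr_wpDl => //; apply: sumr_ge0 => m _; apply: mulr_ge0 => //.
  exact: mulr_ge0.
apply: (@le_trans _ _ (\sum_(m < n.+1) `|g m| * (c m * c (n - m)%N))); last by rewrite lerDl.
apply: le_trans (ler_norm_sum _ _ _) _; apply: ler_sum => m _.
rewrite normrM ler_wpM2l // normrM; apply: ler_pM => //; first exact: le_c.
by apply: le_c; lra.
Qed.

(** The error in the Dumont form vanishes at [y = 0] and has derivative at most [e / (2 * C)], so it
    is at most that times [theta x <= 2 * x]. The factor [x] cancels the denominator, and [C] bounds
    the Entringer form. *)
Lemma double_sum_cvg k1 n (Z : R -> R) : odd k1 -> odd n -> Z 0 = 0 ->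
  primitive_on 0 1 Z
    (fun x => zigzag_form k1 false (theta x) * dumont_form n (theta x) / x) ->
  double_sum k1 n.+2 @ \oo --> Z 1.
Proof.
move=> ok on Z0 pZ.
have [C C0 hC] := bform_bound k1 (fun m => (zigzag k1 false (k1 - m))%:R : R).
apply/cvgrPdist_le => e e0.
have [N0 hN] := dumont_series on (e := e / (2 * C)) ltac:(by rewrite divr_gt0 // mulr_gt0).
exists N0 => // N /= NN.
have [W [W0 pW <-]] := double_sum_primitive n.+2 N ok.
have := primitive_on_bound ler01 (primitive_onB pZ pW) (K := e).
rewrite Z0 W0 !subr0 mulr1; apply => x /andP[x0 x1].
have t0 := theta_gt0 x0; have t1 := theta_lt x1.
rewrite -mulrBl -mulrBr normrM normfV (gtr0_norm x0) ler_pdivrMr // normrM.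
have dQ (y : R) : is_derive y 1 (fun t => dumont_form n t - 4 * sin_sum n.+2 N t)
    (dumont_form' n y - 4 * cos_sum n.+1 N y).
  exact: is_deriveB (is_derive_dumont_form n y) (is_deriveZ 4 (is_derive_sin_sum n.+1 N y)).
have := primitive_on_bound (ltW t0) (derive_primitive_on 0 (theta x) dQ) (K := e / (2 * C)).
rewrite dumont_form_0 sin_sum0 mulr0 !subr0 => h.
have {h} h2 : `|dumont_form n (theta x) - 4 * sin_sum n.+2 N (theta x)| <=
   e / (2 * C) * theta x.
  by apply: h => y /andP[y0 y1]; apply: hN => //; rewrite y0 (lt_trans y1).
have -> : e * x = C * (e / (2 * C) * (2 * x)) by field; rewrite gt_eqF.
apply: ler_pM => //; first by apply: hC; rewrite (ltW t0) (ltW t1).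
apply: le_trans h2 _; rewrite ler_pM2l ?divr_gt0 ?mulr_gt0 //.
exact: theta_le2 (ltW x0).
Qed.

Lemma sum_even_terms (f : nat -> R) N :
  \sum_(i < N) (1 + (-1) ^+ i) * f i = \sum_(t < uphalf N) 2 * f t.*2.
Proof.
elim: N => [|N IHN]; first by rewrite !big_ord0.
rewrite big_ord_recr {}IHN /= uphalf_half -signr_odd.
case: (boolP (odd N)) => oN /=; first by rewrite expr1 subrr mul0r addr0 add1n.
rewrite add0n big_ord_recr /= expr0 (_ : N./2.*2 = N) //.
by rewrite -[RHS]odd_double_half (negbTE oN).
Qed.

Lemma T_Ttilde_partial k1 k2 M :
  T_partial R [:: k1.+1; k2] M + Ttilde_partial R [:: k1.+1; k2] M =
  double_sum k1 k2 (uphalf M./2).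
Proof.
rewrite T_partialE Ttilde_partialE -mulrDr -big_split /= subn2 /=.
under eq_bigr do rewrite -[X in X + _]mul1r -mulrDl.
rewrite (sum_even_terms (tcoef R (nth 0%N [:: k1.+1; k2]) 2)) mulr_sumr.
apply: eq_bigr => t _; rewrite tcoefS /= !mulrA; congr (_ * _).
  rewrite -natrX -natrM /frq; congr (_ * (_ ^+ _)^-1).
  by rewrite -natrM; congr (_%:R); lia.
apply: eq_bigr => j _; rewrite big_ord_recl big1 => [|i _]; last by [].
by rewrite addr0 mulr1 add1n.
Qed.

(** Comparison with the sum of inverse squares: the inner sum has [i.+1] terms, each at most 1, and
    the outer denominator is at least the cube of [i.+1]. *)
Lemma T_partial_cvg k1 k2 : (3 <= k2)%N -> cvgn (T_partial R [:: k1.+1; k2]).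
Proof.
move=> k23; set f := tcoef R (nth 0%N [:: k1.+1; k2]) 2.
have f_ge0 i : 0 <= f i by exact: tcoef_ge0.
have c1_le1 j : tcoef R (nth 0%N [:: k1.+1; k2]) 1 j <= 1.
  rewrite tcoefS big_ord_recl big1 => [|i _]; last by [].
  rewrite addr0 mulr1 invf_le1 ?exprn_gt0 ?ltr0n ?add1n //.
  by rewrite exprn_ege1 // ler1n.
have f_le i : f i <= (i.+1%:R ^+ 2)^-1.
  rewrite /f tcoefS; apply: (@le_trans _ _ (((2 + i.*2)%:R ^+ k2)^-1 * i.+1%:R)).
    rewrite ler_wpM2l ?invr_ge0 ?exprn_ge0 //.
    apply: (@le_trans _ _ (\sum_(j < i.+1) 1)); first by apply: ler_sum => j _.
    by rewrite sumr_const card_ord.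
  have i0 : 0 < i.+1%:R :> R by [].
  rewrite mulrC ler_pdivrMr ?exprn_gt0 ?ltr0n //.
  rewrite -ler_pdivrMl ?invr_gt0 ?exprn_gt0 // invrK -exprSr.
  rewrite -!natrX ler_nat; apply: (@leq_trans ((2 + i.*2) ^ 3)).
    by rewrite leq_exp2r //; lia.
  by rewrite leq_pexp2l.
have sum_le N : \sum_(i < N.+1) f i <= 2 - N.+1%:R^-1.
  elim: N => [|N IHN].
    by rewrite big_ord1; apply: le_trans (f_le 0%N) _; rewrite expr1n invr1 lerBrDr.
  rewrite big_ord_recr /=; have := f_le N.+1.
  suff : (N.+2%:R ^+ 2)^-1 <= N.+1%:R^-1 - N.+2%:R^-1 :> R.
    move: IHN; move: (\sum_(_ < _) _) (f _) (_ ^-1) (_ ^-1) (_ ^-1) => a b c d e.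
    by move=> *; lra.
  have n0 : 0 < N.+1%:R :> R by [].
  rewrite -[N.+2%:R]natr1; move: (N.+1%:R) n0 => x x0.
  have -> : x^-1 - (x + 1)^-1 = (x * (x + 1))^-1 by field; rewrite !gt_eqF //; lra.
  rewrite lef_pV2 ?posrE ?exprn_gt0 ?mulr_gt0 //; [nra|lra|lra].
have TE M : T_partial R [:: k1.+1; k2] M = 2 ^+ 2 * \sum_(i < M./2) f i.
  by rewrite T_partialE -[size _]/2%N subn2.
apply: nondecreasing_is_cvgn => [M M' MM|].
  rewrite !TE ler_pM2l ?exprn_gt0 // (big_ord_widen M'./2 f) ?half_leq //.
  rewrite [leRHS](bigID (fun i : 'I_(M'./2) => (i < M./2)%N)) lerDl.
  by apply: sumr_ge0 => i _; exact: f_ge0.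
exists (2 ^+ 2 * 2) => _ [M _ <-]; rewrite TE ler_pM2l ?exprn_gt0 //.
case: (M./2) => [|N]; first by rewrite big_ord0.
by apply: le_trans (sum_le N) _; rewrite lerBlDr lerDl invr_ge0.
Qed.

End SumFormula.

Theorem theorem1 (R : realType) (k1 k2 : nat)
    (hk1 : (1 <= k1)%N) (hk2 : (3 <= k2)%N) (ok1 : odd k1) (ok2 : odd k2) :
  \sum_(1 <= l < k1.+1) \sum_(1 <= m < k2.+1)
    ('C(k1 - l + m, m) * 'C(k2 - m + l, l)
       * entringer k1 l * dumont k2 m)%N%:R
    * Ttilde R (nseq (k1 - l + m - 1) 1%N ++ 2%N :: nseq (k2 - m + l) 1%N)
  = Tval R [:: k1.+1; k2] + Ttilde R [:: k1.+1; k2].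
Proof.
have [n k2E] : exists n, k2 = n.+2 by exists (k2 - 2)%N; lia.
have on : odd n by move: ok2; rewrite k2E /= negbK.
have [Z [Z0 pZ]] := Ttilde_sum_primitive R n hk1.
rewrite k2E in hk2 *; rewrite /index_2_1s => ->.
have cZ := double_sum_cvg ok1 on Z0 pZ.
have cT := T_partial_cvg (R := R) (k1 := k1) hk2.
have cTT : (fun M => T_partial R [:: k1.+1; n.+2] M + Ttilde_partial R [:: k1.+1; n.+2] M)
    @ \oo --> Z 1.
  under eq_fun do rewrite T_Ttilde_partial.
  (* The number of terms [uphalf M./2] tends to infinity with [M], so this is a reparametrization of
     [double_sum]. *)
  apply: cvg_comp cZ; apply/cvgnyPge => N; exists (N.*2.*2)%N => // M /= NM.
  by rewrite uphalf_half; lia.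
(* The limit defining [Ttilde] exists by difference, since both [T] and the sum [T + Ttilde]
   converge. *)
have cTt : cvgn (Ttilde_partial R [:: k1.+1; n.+2]).
  have -> : Ttilde_partial R [:: k1.+1; n.+2] =
      (fun M => (T_partial R [:: k1.+1; n.+2] M + Ttilde_partial R [:: k1.+1; n.+2] M)
        - T_partial R [:: k1.+1; n.+2] M).
    by apply/funext => M; rewrite addrC addKr.
  by apply: is_cvgB => //; apply: cvgP cTT.
by rewrite /Tval /Ttilde -limD //; apply/esym/cvg_lim.
Qed.
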